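(* Let $G$ be a non-compact $\sigma$-compact locally compact Abelian group. Let $\omega\subseteq G$ be a Delone set of finite local complexity (FLC) with uniform patch frequencies (UPF). If $\omega$ is pure point diffractive, then $\omega$ has topological entropy $0$, i.e. the Delone action $\pi_\omega\colon G\times X_\omega\to X_\omega$, $(g,\xi)\mapsto \xi+g$, satisfies $\operatorname{h_{top}}(\pi_\omega)=0$.
   Context: Locally compact Abelian (LCA) groups are Hausdorff and written additively; $\theta$ is a fixed Haar measure on $G$; $|\cdot|$ denotes cardinality. **Van Hove sequences.** For $A,K\subseteq G$ let $\partial_K A:=(K+A)\cap\overline{K+(G\setminus A)}$. A sequence $(A_n)_{n\in\mathbb N}$ of compact subsets of $G$ is van Hove if $\lim_{n\to\infty}\theta(\partial_KA_n)/\theta(A_n)=0$ for every compact $K\subseteq G$. **Delone sets.** $\omega\subseteq G$ is Delone if it is relatively dense (there is a compact $K\subseteq G$ with $K+\omega=G$) and uniformly discrete (there is a precompact neighbourhood $V$ of $0$ such that $\{V+g;\ g\in\omega\}$ is a disjoint family). **Patches, FLC, UPF.** For compact $A\subseteq G$ let $\operatorname{Pat}_\omega(A):=\{(\omega-g)\cap A;\ g\in\omega\}$; its elements are the $A$-patches of $\omega$. $\omega$ is FLC if $\operatorname{Pat}_\omega(A)$ is finite for every compact $A\subseteq G$. A FLC Delone set $\omega$ has UPF if for every compact $A\subseteq G$, every non-empty $A$-patch $P$ of $\omega$ and every van Hove sequence $(A_n)_{n\in\mathbb N}$ the limit $\lim_{n\to\infty}|\{g\in A_n;\ (\omega-g)\cap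 A=P\}|/\theta(A_n)$ exists. **Pure point diffraction.** A measure $\gamma$ on $G$ is the unique autocorrelation of $\omega$ if for every van Hove sequence $(A_n)$ the measures $\frac{1}{\theta(A_n)}\sum_{g,g'\in A_n\cap\omega}\delta_{g-g'}$ converge to $\gamma$ in the weak*-topology (i.e. tested against continuous compactly supported functions on $G$). Every FLC Delone set with UPF has a unique autocorrelation $\gamma$. This $\gamma$ is positive definite and so has a Fourier transform $\hat\gamma$, the unique positive (Radon) measure on the dual group $\hat G$ with $\int_G f*\tilde f\,d\gamma=\int_{\hat G}|\check f|^2\,d\hat\gamma$ for all continuous compactly supported $f\colon G\to\mathbb C$, where $\tilde f(g)=\overline{f(-g)}$ and $\check f(\chi)=\int_G\chi(g)f(g)\,d\theta(g)$. The set $\omega$ is pure point diffractive if $\hat\gamma$ is a pure point measure. **Delone action.** Let $\mathcal A(G)$ be the set of closed subsets of $G$. For compact $K\subseteq G$ and an open neighbourhood $V$ of $0$ let $\epsilon(K,V)$ be the set of all $(\xi,\zeta)\in\mathcal A(G)^2$ with $\xi\cap K\subseteq\zeta+V$ and $\zeta\cap K\subseteq\xi+V$. There is a compact Hausdorff topology on $\mathcal A(G)$ (the local rubber topology) such that the sets $\epsilon(K,V)$ form a base of its uniformity. $X_\omega$ is the closure of $\{\omega+g;\ g\in G\}$ in $\mathcal A(G)$, and $\pi_\omega$ is the (continuous) translation action of $G$ on $X_\omega$. **Topological entropy.** For a continuous action $\pi$ of $G$ on a compact Hausdorff space $X$, with $\pi^g:=\pi(g,\cdot)$, let $\mathbb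 U_X$ be the set of all neighbourhoods of the diagonal in $X\times X$. For $\eta\in\mathbb U_X$ and compact $A\subseteq G$ let $\eta_A:=\{(x,y)\in X^2;\ \forall g\in A\colon(\pi^g(x),\pi^g(y))\in\eta\}$, which again belongs to $\mathbb U_X$. For symmetric $\eta\in\mathbb U_X$ let $\operatorname{sep}_X(\eta)$ be the maximal cardinality of a subset $E\subseteq X$ such that $(x,y)\notin\eta$ for all distinct $x,y\in E$ (this is finite). Then $$\operatorname{h_{top}}(\pi):=\sup_{\eta}\limsup_{n\to\infty}\frac{\log(\operatorname{sep}_X(\eta_{A_n}))}{\theta(A_n)},$$ where $(A_n)$ is a van Hove sequence (the value does not depend on its choice) and the supremum is over all symmetric $\eta\in\mathbb U_X$. *)

(* Defs.v *)
From HB Require Import structures.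
From mathcomp Require Import all_boot all_order all_algebra finmap.
From mathcomp Require Import complex.
From mathcomp Require Import all_classical all_reals all_analysis.
Set Implicit Arguments.
Unset Strict Implicit.
Unset Printing Implicit Defensive.
Import Order.TTheory GRing.Theory Num.Theory.
Import numFieldNormedType.Exports.
Local Open Scope classical_set_scope.
Local Open Scope ring_scope.

HB.mixin Record TopologicalZmodule_isLCA G & TopologicalZmodule G := {
  lca_hausdorff : hausdorff_space G;
  lca_locally_compact : locally_compact [set: G] }.

#[short(type="lcaGroupType")]
HB.structure Definition LCAGroup :=
  {G of TopologicalZmodule G & TopologicalZmodule_isLCA G}.

Definition sigma_compact (T : topologicalType) : Prop :=
  exists K : nat -> set T, (forall n, compact (K n)) /\ \bigcup_n K n = setT.

(* Measurable types are pointed in the library while topological groups are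
   not, so Borel spaces are taken with an explicit base point, which plays no
   role otherwise. *)
Definition pointed_at (T : choiceType) (x0 : T) : Type := T.
HB.instance Definition _ (T : choiceType) (x0 : T) :=
  Choice.on (pointed_at x0).
HB.instance Definition _ (T : choiceType) (x0 : T) :=
  isPointed.Build (pointed_at x0) x0.

Definition borel (T : topologicalType) (x0 : T) : Type :=
  g_sigma_algebraType (@open T : set (set (pointed_at x0))).
HB.instance Definition _ (T : topologicalType) (x0 : T) :=
  Measurable.on (borel x0).

Section RadonMeasures.
Variables (R : realType) (T : topologicalType) (x0 : T).
Implicit Type mu : {measure set (borel x0) -> \bar R}.

(* Inner regularity is required on all Borel sets; on spaces that are not
   sigma-compact this differs from the convention that asks for outer
   regularity on Borel sets and inner regularity on open sets only. *)
Definition is_radon mu : Prop :=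
  (forall K : set T, compact K -> (mu K < +oo)%E) /\
  (forall B : set (borel x0), measurable B ->
    mu B = ereal_sup [set mu K | K in [set K : set T | compact K /\ K `<=` B]]).

Definition is_pure_point mu : Prop :=
  forall B : set (borel x0), measurable B ->
    mu B = (\esum_(x in B) mu [set x])%E.

Local Open Scope complex_scope.

Definition cintegral mu (f : T -> R[i]) : R[i] :=
  (\int[mu]_x complex.Re (f x)) +i* (\int[mu]_x complex.Im (f x)).

End RadonMeasures.

Section Groups.
Variables (R : realType) (G : lcaGroupType).

Definition sumset (A B : set G) : set G := [set a + b | a in A & b in B].
Definition shiftset (A : set G) (g : G) : set G := [set a + g | a in A].

Notation borelG := (borel (0 : G)).
Implicit Type theta gamma : {measure set borelG -> \bar R}.

Definition is_haar theta : Prop :=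
  [/\ is_radon theta, theta setT != 0%E &
      forall (g : G) (B : set borelG), measurable B -> theta (shiftset B g) = theta B].

Definition van_hove_boundary (K A : set G) : set G :=
  sumset K A `&` closure (sumset K (~` A)).

(* The condition 0 < theta (A n) only makes the quotients meaningful. *)
Definition van_hove theta (A : nat -> set G) : Prop :=
  [/\ forall n, compact (A n),
      forall n, (0 < theta (A n))%E &
      forall K, compact K ->
        fine (theta (van_hove_boundary K (A n))) / fine (theta (A n))
          @[n --> \oo] --> (0 : R)].

Definition relatively_dense (omega : set G) : Prop :=
  exists2 K : set G, compact K & sumset K omega = setT.

Definition uniformly_discrete (omega : set G) : Prop :=
  exists V : set G,
    [/\ nbhs 0 V, precompact V & trivIset omega (fun g => shiftset V g)].

Definition delone (omega : set G) : Prop :=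
  relatively_dense omega /\ uniformly_discrete omega.

Lemma uniformly_discrete_closed (omega : set G) :
  uniformly_discrete omega -> closed omega.
Proof.
move=> [V [nV _ tV]] p clp.
have nW : nbhs p ((fun x => x - p) @^-1` V).
  have : {for p, continuous (fun x : G => x - p)}.
    apply: (@continuous_comp _ _ _ (fun x : G => (x, p))
      (fun x : G * G => x.1 - x.2)); last exact: sub_continuous.
    by apply: cvg_pair => /=; [exact: cvg_id|exact: cvg_cst].
  by apply; rewrite /= subrr.
have [g [og Vg]] := clp _ nW.
have [<-//|gp] := eqVneq g p.
have ng : nbhs p (~` [set g]).
  apply: open_nbhs_nbhs; split; last by move=> /= pg; rewrite pg eqxx in gp.
  apply: closed_openC; apply: accessible_closed_set1.
  exact: hausdorff_accessible lca_hausdorff.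
have [h [oh [Vh hg]]] := clp _ (filterI nW ng).
case: hg; apply: tV => //; exists (h - p + g).
by split; [exists (g - p) => //; rewrite addrC addrCA addrC|exists (h - p)].
Qed.

Definition patch_at (omega A : set G) (g : G) : set G := shiftset omega (- g) `&` A.

Definition Pat (omega A : set G) : set (set G) :=
  [set patch_at omega A g | g in omega].

Definition FLC (omega : set G) : Prop :=
  forall A, compact A -> finite_set (Pat omega A).

(* The set being counted is finite when omega is uniformly discrete, P is
   non-empty and Ahat n is compact. *)
Definition UPF theta (omega : set G) : Prop :=
  forall (A P : set G) (Ahat : nat -> set G),
    compact A -> Pat omega A P -> P !=set0 -> van_hove theta Ahat ->
    cvgn (fun n =>
      #|` fset_set [set g | Ahat n g /\ patch_at omega A g = P] |%:R
        / fine (theta (Ahat n)) : R).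

Definition Cc (f : G -> R[i]) : Prop :=
  continuous (f : G -> R[i]^o) /\ compact (closure [set g | f g != 0]).

Definition is_autocorrelation theta (omega : set G) gamma : Prop :=
  forall A : nat -> set G, van_hove theta A -> forall f, Cc f ->
    ((\sum_(g \in A n `&` omega) \sum_(g' \in A n `&` omega) f (g - g'))
       / (fine (theta (A n)))%:C%C : R[i]^o)
      @[n --> \oo] --> (cintegral gamma f : R[i]^o).

(* Continuous characters, with the compact-open topology. *)
Definition characters : set {compact-open, G -> R[i]^o} :=
  [set chi : G -> R[i]^o |
    [/\ continuous chi, forall g, `|chi g| = 1 &
        forall g h, chi (g + h) = chi g * chi h]].

Lemma characters1 : characters (fun=> 1).
Proof.
split=> [|g|g h]; [exact: cst_continuous | exact: normr1 | by rewrite mulr1].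
Qed.

Definition dual_group : Type := characters.
HB.instance Definition _ := Topological.on dual_group.

Definition dual1 : dual_group := exist (fun chi => chi \in characters) _ (mem_set characters1).

Definition char_val (chi : dual_group) : G -> R[i] := val chi.

Definition convolution theta (f h : G -> R[i]) (g : G) : R[i] :=
  cintegral theta (fun x => f x * h (g - x)).

Definition tilde (f : G -> R[i]) (g : G) : R[i] := (f (- g))^*.

Definition inv_fourier theta (f : G -> R[i]) (chi : dual_group) : R[i] :=
  cintegral theta (fun g => char_val chi g * f g).

Definition is_fourier_transform theta gamma
    (gammahat : {measure set (borel dual1) -> \bar R}) : Prop :=
  is_radon gammahat /\
  forall f, Cc f ->
    gammahat.-integrable setT
      (fun chi => (complex.Re (`|inv_fourier theta f chi| ^+ 2))%:E) /\
    cintegral gamma (convolution theta f (tilde f)) =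
    cintegral gammahat (fun chi => `|inv_fourier theta f chi| ^+ 2).

Definition pure_point_diffractive theta (omega : set G) : Prop :=
  exists gamma (gammahat : {measure set (borel dual1) -> \bar R}),
    [/\ is_radon gamma, is_autocorrelation theta omega gamma,
        is_fourier_transform theta gamma gammahat & is_pure_point gammahat].

End Groups.

Section Entropy.
Variables (R : realType) (G : lcaGroupType) (X : topologicalType).
Variable pi : G -> X -> X.

Definition bowen (eta : set (X * X)) (A : set G) : set (X * X) :=
  [set xy | forall g, A g -> eta (pi g xy.1, pi g xy.2)].

Definition sep (eta : set (X * X)) : \bar R :=
  ereal_sup [set (#|` E|%:R)%:E | E in
    [set E : {fset X} |
      forall x y, x \in E -> y \in E -> x != y -> ~ eta (x, y)]].

Definition htop (theta : {measure set (borel (0 : G)) -> \bar R})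
    (A : nat -> set G) : \bar R :=
  ereal_sup
    [set limn_esup
           (fun n => (lne (sep (bowen eta (A n))) * (fine (theta (A n)))^-1%:E)%E)
    | eta in [set eta : set (X * X) |
        set_nbhs diagonal eta /\ forall x y, eta (x, y) -> eta (y, x)]].

End Entropy.

Record closed_subset (T : topologicalType) := ClosedSubset {
  closed_subset_val :> set T;
  closed_subsetP : closed closed_subset_val }.
HB.instance Definition _ (T : topologicalType) :=
  gen_eqMixin (closed_subset T).
HB.instance Definition _ (T : topologicalType) :=
  gen_choiceMixin (closed_subset T).

Lemma closed_subset_inj (T : topologicalType) :
  injective (@closed_subset_val T).
Proof.
move=> [A cA] [B cB] /= AB; move: cA cB; rewrite AB => cA cB.
by rewrite (Prop_irrelevance cA cB).
Qed.

Section LocalRubber.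
Variable G : lcaGroupType.

Definition rubber_eps (K V : set G) : set (closed_subset G * closed_subset G) :=
  [set p : closed_subset G * closed_subset G |
    p.1 `&` K `<=` sumset p.2 V /\ p.2 `&` K `<=` sumset p.1 V].

Definition rubber_entourage : set_system (closed_subset G * closed_subset G) :=
  filter_from
    [set KV : set G * set G | [/\ compact KV.1, open KV.2 & KV.2 0]]
    (fun KV => rubber_eps KV.1 KV.2).

Lemma sumsetS (A B C : set G) : B `<=` C -> sumset A B `<=` sumset A C.
Proof. by move=> BC _ [a Aa [b /BC Cb <-]]; exists a => //; exists b. Qed.

Lemma rubber_epsS (K K' V V' : set G) : K `<=` K' -> V' `<=` V ->
  rubber_eps K' V' `<=` rubber_eps K V.
Proof.
move=> KK' VV' [A B] [/= h1 h2]; split => /= x [Ax Kx].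
  by apply: sumsetS VV' _ (h1 _ _); split=> //; exact: KK'.
by apply: sumsetS VV' _ (h2 _ _); split=> //; exact: KK'.
Qed.

Lemma rubber_filter : Filter rubber_entourage.
Proof.
apply: filter_from_filter.
  by exists (set0, setT) => /=; split=> //; [exact: compact0|exact: openT].
move=> [K V] [K' V'] /= [cK oV V0] [cK' oV' V'0].
exists (K `|` K', V `&` V') => /=.
  by split; [exact: compactU|exact: openI|].
by move=> p hp; split; apply: rubber_epsS hp.
Qed.

Lemma rubber_diagonal E : rubber_entourage E -> diagonal `<=` E.
Proof.
case=> -[K V] /= [_ _ V0] KVE [A B] /diagonalP <-; apply: KVE.
by split=> /= x [Ax _]; exists x => //; exists 0 => //; rewrite addr0.
Qed.

Lemma rubber_inv E : rubber_entourage E -> rubber_entourage E^-1%relation.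
Proof.
by case=> KV hKV KVE; exists KV => // -[A B] [/= h1 h2]; exact: KVE.
Qed.

Lemma half_nbhd (V : set G) : open V -> V 0 ->
  exists W U : set G, [/\ compact W, open U, U 0, U `<=` W & sumset U U `<=` V].
Proof.
move=> oV V0.
have : nbhs ((0, 0) : G * G) ((fun x : G * G => x.1 + x.2) @^-1` V).
  apply: (@add_continuous G (0, 0)) => /=.
  by rewrite addr0; exact: open_nbhs_nbhs.
case=> -[A B] /= [nA nB] AB.
have [W nW [cW _]] := @lca_locally_compact G 0 I.
move: nW; rewrite withinET => nW.
exists W, ((A `&` B) `&` W)^°; split=> //.
- exact: open_interior.
- by do 2!apply: filterI => //.
- by move=> x /interior_subset [].
- move=> _ [a /interior_subset [[Aa _] _] [b /interior_subset [[_ Bb] _] <-]].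
  exact: (AB (a, b)).
Qed.

Lemma rubber_split E : rubber_entourage E ->
  exists2 D, rubber_entourage D & (D \; D `<=` E)%relation.
Proof.
case=> -[K V] /= [cK oV V0] KVE.
have [W [U [cW oU U0 UW UUV]]] := half_nbhd oV V0.
pose K' : set G := (fun x : G * G => x.1 - x.2) @` (K `*` W).
have cK' : compact K'.
  apply: continuous_compact; last exact: compact_setX.
  by apply: continuous_subspaceT => x; exact: sub_continuous.
have KK' : K `<=` K'.
  by move=> x Kx; exists (x, 0); rewrite /= ?subr0//; split=> //; exact: UW.
have step (A B C : closed_subset G) : A `&` K' `<=` sumset B U ->
    B `&` K' `<=` sumset C U -> A `&` K `<=` sumset C V.
  move=> AB BC x [Ax Kx]; have [|z Bz [v Uv zvx]] := AB x.
    by split=> //; exact: KK'.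
  have [|c Cc [v' Uv' cvz]] := BC z.
    split=> //; exists (x, v) => /=; last by rewrite -zvx addrK.
    by split=> //; exact: UW.
  exists c => //; exists (v' + v); last by rewrite addrA cvz.
  by apply: UUV; exists v' => //; exists v.
exists (rubber_eps K' U); first by exists (K', U).
move=> [A C] [B [/= AB BA] [/= BC CB]]; apply: KVE; split=> /=.
  exact: step AB BC.
exact: step CB BA.
Qed.

HB.instance Definition _ := isUniform.Build (closed_subset G)
  rubber_filter rubber_diagonal rubber_inv rubber_split.

Lemma closed_shift (A : closed_subset G) (g : G) : closed (shiftset A g).
Proof.
have -> : shiftset A g = (fun x => x - g) @^-1` A.
  apply/seteqP; split=> x /=; first by move=> [a Aa <-]; rewrite addrK.
  by move=> Ax; exists (x - g) => //; rewrite subrK.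
apply: closed_comp; last exact: closed_subsetP.
move=> x _; apply: (@continuous_comp _ _ _ (fun x : G => (x, g))
   (fun x : G * G => x.1 - x.2)); last exact: sub_continuous.
by apply: cvg_pair => /=; [exact: cvg_id|exact: cvg_cst].
Qed.

Definition translate (g : G) (A : closed_subset G) : closed_subset G :=
  ClosedSubset (@closed_shift A g).

Lemma compact_shift (K : set G) (g : G) : compact K -> compact (shiftset K g).
Proof.
move=> cK; apply: (@continuous_compact _ _ (fun x : G => x + g)) => //.
apply: continuous_subspaceT => x.
apply: (@continuous_comp _ _ _ (fun x : G => (x, g))
  (fun x : G * G => x.1 + x.2)); last exact: add_continuous.
by apply: cvg_pair => /=; [exact: cvg_id|exact: cvg_cst].
Qed.

Lemma translate_continuous (g : G) : continuous (translate g).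
Proof.
move=> A B /nbhsP[E [[K V] /= [cK oV V0] KVE] EB].
apply/nbhsP; exists (rubber_eps (shiftset K (- g)) V).
  by exists (shiftset K (- g), V) => //=; split=> //; exact: compact_shift.
have step (C D : closed_subset G) :
    C `&` shiftset K (- g) `<=` sumset D V ->
    shiftset C g `&` K `<=` sumset (shiftset D g) V.
  move=> CD _ [[c Cc <-] Kc]; have [|d Dd [v Vv dvc]] := CD c.
    by split=> //; exists (c + g) => //; rewrite addrK.
  by exists (d + g); [exists d | exists v => //; rewrite addrAC dvc].
move=> C /xsectionP [/= h1 h2]; apply/EB/xsectionP/KVE; split=> /=.
  exact: step h1.
exact: step h2.
Qed.

(* A uniformly discrete omega is closed (uniformly_discrete_closed), so the set
   whose closure is taken is the full orbit of omega. *)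
Definition hull (omega : set G) : set (closed_subset G) :=
  closure [set xi : closed_subset G | exists g, xi = shiftset omega g :> set G].

Lemma hull_translate (omega : set G) (g : G) (xi : closed_subset G) :
  hull omega xi -> hull omega (translate g xi).
Proof.
move=> hxi B /(@translate_continuous g xi)/hxi [zeta [[h zh] Bz]].
exists (translate g zeta); split=> //; exists (h + g) => /=; rewrite zh.
apply/seteqP; split=> [_ [_ [x ox <-] <-]|_ [x ox <-]].
  by exists x => //; rewrite addrA.
by exists (x + h); [exists x | rewrite addrA].
Qed.

Definition delone_action (omega : set G) (g : G) (xi : hull omega) :
    hull omega :=
  exist _ (translate g (val xi))
    (mem_set (@hull_translate omega g _ (set_mem (valP xi)))).

End LocalRubber.

(* Main.v *)
(** Let f be a bump function with small support and D := f - f(. - t). Testing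
    the autocorrelation against D * D~ along a van Hove sequence counts, up to a
    factor, the bad points g of omega, for which g + t is not close to omega.
    The limit is the integral of |1 - chi(t)|^2 |f^(chi)|^2 against gamma^, and,
    gamma^ being pure point, finitely many characters carry almost all of its
    mass. Hence the density of bad points is small, uniformly over translates of
    omega, once chi(t) is close to 1 for these finitely many characters chi. As
    the torus is totally bounded and G is not compact, arbitrarily many such t
    can be found, spread out arbitrarily far.

    Given k such periods, consider a grid of N small cells covering the window.
    By a greedy choice, a small proportion of the cells has the property that
    almost every cell is translated into it by one of the periods. Recording
    omega + h on these few cells and on the few exceptional cells determines
    omega + h up to a small error on the whole window: every other cell copies
    the state of its translate. So the number of distinguishable translates is
    bounded by the number of triples of small subsets of the N cells, and its
    logarithm is at most delta N, for any given delta > 0.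

    The windows that matter are of the form K - A_n. They are handled with the
    packing inequality theta(X) <= C theta(Q - X) in place of the invariance of
    Haar measure under inversion. *)
Require Import Defs.
From mathcomp Require Import all_boot all_order all_algebra.
From mathcomp Require Import finmap complex ring lra.
Set Implicit Arguments.
Unset Strict Implicit.
Unset Printing Implicit Defensive.
Import Order.TTheory GRing.Theory Num.Theory.
Local Open Scope ring_scope.

(** * Combinatorics of finite sets *)

(* These come before the import of [classical_sets], which shadows the notations
   and many lemma names of [finset]. *)

Section Combinatorics.
Local Open Scope nat_scope.

(** Take [S] of maximal size among the sets whose members cover at least [M] elements each on
    average. By maximality no [z] is related to more than [M] of the elements that [S] leaves
    uncovered, since adding it would keep the average. Counting the related pairs with an uncovered
    second entry in two ways gives the second bound. *)
Lemma greedy_cover (J : finType) (r : rel J) (J0 : {set J}) (M k : nat) :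
  0 < M -> (forall y, y \in J0 -> k <= #|[set z | r z y]|) ->
  exists S : {set J}, #|S| * M <= #|J| /\
    #|[set y in J0 | [forall z in S, ~~ r z y]]| * k <= M * #|J|.
Proof.
move=> M0 degk; pose cov (S : {set J}) := [set y | [exists z in S, r z y]].
pose P (S : {set J}) := #|S| * M <= #|cov S|.
have P0 : P set0 by rewrite /P cards0.
pose S := [arg max_(S > set0 | P S) #|S|].
have [PS Smax] : P S /\ forall S', P S' -> #|S'| <= #|S|.
  by rewrite /S; case: arg_maxnP.
exists S; split; first exact: leq_trans PS (max_card _).
set U := [set y in J0 | _].
have Ucov y : y \in U -> y \notin cov S.
  rewrite !inE => /andP[_ /forall_inP h]; rewrite negb_exists.
  by apply/forallP => z; rewrite negb_and; case: (boolP (z \in S)) => //= /h.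
have few z : #|[set y in U | r z y]| <= M.
  rewrite leqNgt; apply/negP => big.
  have zS : z \notin S.
    apply/negP => zS; have [y] : exists y, y \in [set y in U | r z y].
      by apply/card_gt0P; exact: leq_ltn_trans big.
    rewrite inE => /andP[/Ucov]; rewrite inE negb_exists => /forallP/(_ z).
    by rewrite zS /= => /negPf->.
  have : P (z |: S).
    rewrite /P cardsU1 zS mulnDl mul1n.
    apply: (@leq_trans #|[set y in U | r z y] :|: cov S|).
      rewrite cardsU disjoint_setI0 ?cards0 ?subn0; last first.
        rewrite disjoint_subset; apply/subsetP => y; rewrite inE => /andP[yU _].
        exact: Ucov.
      by apply: leq_add => //; exact: ltnW.
    apply: subset_leq_card; apply/subsetP => y; rewrite inE => /orP[].
      rewrite inE => /andP[_ rzy]; rewrite inE; apply/existsP; exists z.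
      by rewrite setU11.
    rewrite !inE => /existsP[z' /andP[z'S rz'y]]; apply/existsP; exists z'.
    by rewrite setU1r.
  by move=> /Smax; rewrite cardsU1 zS ltnn.
have -> : M * #|J| = \sum_(z : J) M by rewrite sum_nat_const mulnC.
apply: (@leq_trans (\sum_(z : J) #|[set y in U | r z y]|)); last exact: leq_sum.
have -> : \sum_(z : J) #|[set y in U | r z y]| = \sum_(y in U) #|[set z | r z
  y]|.
  under eq_bigr do rewrite -sum1dep_card big_mkcond.
  under [RHS]eq_bigr do rewrite -sum1dep_card big_mkcond.
  rewrite exchange_big /= [RHS]big_mkcond /=; apply: eq_bigr => y _.
  by case: ifP => yU /=; [apply: eq_bigr|rewrite big1].
rewrite -sum_nat_const; apply: leq_sum => y; rewrite inE => /andP[yJ0 _].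
exact: degk.
Qed.

Lemma card_fibers (J : finType) (T : eqType) (f : J -> T) (c : nat) (ps : seq
  T) :
  forall Y : {set J}, (forall y, y \in Y -> f y \in ps) ->
  (forall p, #|[set y in Y | f y == p]| <= c) -> #|Y| <= c * size ps.
Proof.
elim: ps => [|p ps ih] Y Yps fib.
  rewrite muln0 leqn0 cards_eq0; apply/eqP/setP => y; rewrite inE.
  by apply/negP => /Yps.
rewrite -(cardsID [set y | f y == p] Y) mulnS; apply: leq_add.
  by apply: leq_trans (fib p); apply: subset_leq_card; apply/subsetP => y;
     rewrite !inE.
apply: ih => [y|q].
  by rewrite !inE => /andP[/negPf fyp /Yps]; rewrite inE fyp.
apply: leq_trans (fib q); apply: subset_leq_card; apply/subsetP => y.
by rewrite !inE => /andP[/andP[_ ->] ->].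
Qed.

Lemma card_cover_seq (J : finType) (T : eqType) (F : T -> {set J}) (c : nat)
    (U : {set J}) (r : seq T) : forall E : {set J},
  (forall y, y \in E -> y \in U \/ exists2 t, t \in r & y \in F t) ->
  (forall t, t \in r -> #|F t| <= c) -> #|E| <= #|U| + size r * c.
Proof.
elim: r => [|t r ih] E EU Fc.
  rewrite addn0; apply: subset_leq_card; apply/subsetP => y /EU[//|[]//].
rewrite -(cardsID (F t) E) /= mulSn addnCA leq_add//.
  by apply: leq_trans (Fc t (mem_head _ _));
    exact: subset_leq_card (subsetIr _ _).
apply: ih => [y|t' t'r]; last by apply: Fc; rewrite inE t'r orbT.
rewrite inE => /andP[yt /EU[|[t']]]; first by left.
rewrite inE => /orP[/eqP->|t'r yt']; first by rewrite (negPf yt).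
by right; exists t'.
Qed.

Local Open Scope ring_scope.

(** Expand [(1 + x) ^+ N] as the sum of [x ^+ #|A|] over all subsets [A]. As [x] is at most 1, each
    subset with at most [e] elements contributes at least [x ^+ e]. *)
Lemma card_small_subsets (R : numDomainType) (N e : nat) (x : R) :
  0 <= x <= 1 -> #|[set A : {set 'I_N} | (#|A| <= e)%N]|%:R * x ^+ e <= (1 + x)
    ^+ N.
Proof.
move=> /andP[x0 x1].
have -> : (1 + x) ^+ N = \sum_(A : {set 'I_N}) x ^+ #|A|.
  rewrite addrC -[in LHS](card_ord N) -prodr_const.
  rewrite (eq_bigl xpredT) ?bigA_distr//; apply: eq_bigr => A _.
  by rewrite -big_mkcond /= prodr_const.
rewrite -sum1dep_card natr_sum mulr_suml big_mkcond /=; apply: ler_sum => A _.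
case: ifP => [Ae|_]; last exact: exprn_ge0.
by rewrite mul1r; apply: ler_wiXn2l.
Qed.

End Combinatorics.

From mathcomp Require Import all_classical all_reals all_analysis.
From mathcomp Require Import measurable_realfun.
Import numFieldNormedType.Exports.
Local Open Scope classical_set_scope.

(** * Identities in abelian groups *)

Section AbelianGroupReflection.
Variable V : zmodType.

Inductive zterm := ZVar of nat | ZZero | ZAdd of zterm & zterm | ZOpp of zterm.

Fixpoint zeval (e : seq V) t : V := match t with
  | ZVar i => e`_i | ZZero => 0
  | ZAdd a b => zeval e a + zeval e b | ZOpp a => - zeval e a end.

Fixpoint zcoef t i : int := match t with
  | ZVar j => (j == i)%:Z | ZZero => 0
  | ZAdd a b => zcoef a i + zcoef b i | ZOpp a => - zcoef a i end.

Lemma zevalE e t : zeval e t = \sum_(i < size e) e`_i *~ zcoef t i.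
Proof.
elim: t => /= [j||a -> b ->|a ->].
- have [ltj|gej] := ltnP j (size e); last first.
    rewrite nth_default// big1// => i _; case: eqP => [ji|_];
      last by rewrite mulr0z.
    by move: gej; rewrite ji leqNgt ltn_ord.
  rewrite (bigD1 (Ordinal ltj))//= eqxx big1 ?addr0// => i.
  by rewrite -val_eqE /= eq_sym => /negPf->; rewrite mulr0z.
- by rewrite big1// => i _; rewrite mulr0z.
- by rewrite -big_split; apply: eq_bigr => i _; rewrite mulrzDr.
- by rewrite -sumrN; apply: eq_bigr => i _; rewrite mulrNz.
Qed.

(** The premise compares integer coefficients of closed terms, so it is decided by computation. *)
Lemma zeval_eq e t u :
  all (fun i => zcoef t i == zcoef u i) (iota 0 (size e)) ->
  zeval e t = zeval e u.
Proof.
move=> /allP tu; rewrite !zevalE; apply: eq_bigr => i _.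
by rewrite (eqP (tu i _))// mem_iota ltn_ord.
Qed.

End AbelianGroupReflection.

(* [zmod] proves identities in abelian groups, to which [ring] does not apply. *)
Ltac zfind x e := lazymatch e with
  | x :: _ => constr:(O)
  | _ :: ?e' => let n := zfind x e' in constr:(S n) end.
Ltac zvars t e := lazymatch t with
  | ?a + ?b => let e := zvars a e in zvars b e
  | - ?a => zvars a e
  | 0 => e
  | ?x => match e with
          | _ => let _ := zfind x e in e
          | _ => constr:(x :: e) end end.
Ltac zreify t e := lazymatch t with
  | ?a + ?b => let a := zreify a e in let b := zreify b e in constr:(ZAdd a b)
  | - ?a => let a := zreify a e in constr:(ZOpp a)
  | 0 => constr:(ZZero)
  | ?x => let n := zfind x e in constr:(ZVar n) end.
Ltac zmod := lazymatch goal with |- @eq ?V ?t ?u =>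
  let e := zvars t (@nil V) in let e := zvars u e in
  let a := zreify t e in let b := zreify u e in
  exact: (@zeval_eq _ e a b) end.

(** * Topology and packings of the group *)

Section GroupTopology.
Variable G : lcaGroupType.
Implicit Types (A K V W U : set G) (x y z g h : G).

Lemma addl_continuous h : continuous (fun x : G => h + x).
Proof.
move=> x; apply: (@continuous_comp _ _ _ (fun x : G => (h, x))
  (fun p : G * G => p.1 + p.2)); last exact: add_continuous.
by apply: cvg_pair => /=; [exact: cvg_cst|exact: cvg_id].
Qed.

Lemma addr_continuous h : continuous (fun x : G => x + h).
Proof. by under eq_fun do rewrite addrC; exact: addl_continuous. Qed.

Lemma subl_continuous h : continuous (fun x : G => h - x).
Proof.
move=> x; apply: (@continuous_comp _ _ _ (fun x : G => (h, x))
  (fun p : G * G => p.1 - p.2)); last exact: sub_continuous.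
by apply: cvg_pair => /=; [exact: cvg_cst|exact: cvg_id].
Qed.

Lemma lca_compact_closed K : compact K -> closed K.
Proof. exact: compact_closed lca_hausdorff. Qed.

Lemma nbhs_sub x V : nbhs 0 V -> nbhs x [set y | V (y - x)].
Proof. by move=> nV; apply: (@addr_continuous (- x) x); rewrite subrr. Qed.

Lemma compact_sumset A B : compact A -> compact B -> compact (sumset A B).
Proof.
move=> cA cB.
have -> : sumset A B = (fun p : G * G => p.1 + p.2) @` (A `*` B).
  apply/seteqP; split=> [_ [a Aa [b Bb <-]]|_ [[a b] [/= Aa Bb] <-]].
    by exists (a, b).
  by exists a => //; exists b.
apply: continuous_compact; last exact: compact_setX.
by apply: continuous_subspaceT => p; exact: add_continuous.
Qed.

Lemma compact_opp A : compact A -> compact (-%R @` A).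
Proof.
move=> cA; apply: continuous_compact => //.
by apply: continuous_subspaceT => p; exact: opp_continuous.
Qed.

Lemma open_addr h V : open V -> open [set x | V (x + h)].
Proof. by move=> oV; apply: open_comp oV => x _; exact: addr_continuous. Qed.

(* Entourage-style neighbourhoods of 0: [W (x - y)] reads "x is W-close to y". *)
Definition sym_nbhd W := [/\ open W, W 0, (forall x, W x -> W (- x)) &
  exists2 K, compact K & W `<=` K].

Lemma sym_nbhdN W x y : sym_nbhd W -> W (x - y) -> W (y - x).
Proof. by move=> [_ _ sW _] /sW; rewrite opprB. Qed.

Lemma sym_nbhd_nbhs W : sym_nbhd W -> nbhs 0 W.
Proof. by case=> oW W0 _ _; exact: open_nbhs_nbhs. Qed.

(** The substitute for halving a radius: closeness with respect to [W] composes to closeness with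
    respect to [V]. *)
Lemma sym_nbhd_half V : nbhs 0 V ->
  exists W, [/\ sym_nbhd W, W `<=` V &
    forall x y z, W (x - y) -> W (y - z) -> V (x - z)].
Proof.
rewrite nbhsE => -[V' [oV' V'0] V'V].
have [K [U [cK oU U0 UK UUV]]] := half_nbhd oV' V'0.
have UV' : U `<=` V'.
  by move=> x Ux; apply: UUV; exists x => //; exists 0; rewrite ?addr0.
exists (U `&` [set x | U (- x)]); split.
- split.
  + by apply: openI => //; apply: open_comp oU => x _; exact: opp_continuous.
  + by split; rewrite //= oppr0.
  + by move=> x [Ux Uox]; split; rewrite //= opprK.
  + by exists K => // x [/UK].
- by move=> x [/UV'/V'V].
- move=> x y z [Uxy _] [Uyz _]; apply/V'V/UUV.
  by exists (x - y) => //; exists (y - z) => //; rewrite addrA subrK.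
Qed.

Lemma compact_finite_cover K W : compact K -> nbhs 0 W ->
  exists s : seq G, forall x, K x -> exists2 y, y \in s & W (x - y).
Proof.
move=> /compact_near_coveringP cK nW.
(* Finite lists directed by inclusion: a property near [F] holds for all lists that contain some
   fixed list. *)
pose F : set_system (seq G) :=
  filter_from [set: seq G] (fun s => [set s' : seq G | {subset s <= s'}]).
have FF : Filter F.
  apply: filter_from_filter; first by exists [::].
  move=> s1 s2 _ _; exists (s1 ++ s2) => // s' /= sub; split=> x xs;
    by apply: sub; rewrite mem_cat xs ?orbT.
have := cK _ F (fun s x => exists2 y, y \in s & W (x - y)) FF.
case.
  move=> x Kx; exists ([set y | W (y - x)], [set s : seq G | x \in s]) => /=.
    split; first exact: nbhs_sub.
    by exists [:: x] => // s; apply; exact: mem_head.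
  by move=> [y s] /= [Wyx xs]; exists x.
by move=> s _ sub; exists s; apply: sub => x.
Qed.

Definition far_apart W (s : seq G) :=
  forall x y, x \in s -> y \in s -> W (x - y) -> x = y.

(** Pigeonhole: cover [K] by finitely many translates of a half neighbourhood. Two points of [s] in
    the same translate are [W]-close, hence equal. *)
Lemma far_apart_size K W : compact K -> nbhs 0 W -> exists n : nat, forall s,
  uniq s -> {subset s <= K} -> far_apart W s -> (size s <= n)%N.
Proof.
move=> cK nW; have [U [gU UW UUW]] := sym_nbhd_half nW.
have [c cP] := compact_finite_cover cK (sym_nbhd_nbhs gU).
exists (size c) => s us sK sepW.
have fP x : exists y, x \in s -> y \in c /\ U (x - y).
  have [xs|] := boolP (x \in s); last by exists 0.
  by have [y yc Uxy] := cP x (set_mem (sK x xs)); exists y.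
pose f x := projT1 (cid (fP x)).
have fE x : x \in s -> f x \in c /\ U (x - f x) := projT2 (cid (fP x)).
rewrite -(size_map f s); apply: uniq_leq_size.
  rewrite map_inj_in_uniq// => x y xs ys fxy; apply: sepW => //.
  have [_ Ux] := fE x xs; have [_ Uy] := fE y ys.
  by apply: (UUW _ (f x)) => //; apply: sym_nbhdN => //; rewrite fxy.
by move=> _ /mapP[x xs ->]; have [] := fE x xs.
Qed.

(** A far apart list of maximal size works, because a point of [K] that is close to none of its
    members could be added to it. *)
Lemma maximal_far_apart K W : compact K -> sym_nbhd W -> exists s : seq G,
  [/\ uniq s, {subset s <= K}, far_apart W s &
      forall x, K x -> exists2 y, y \in s & W (x - y)].
Proof.
move=> cK gW; have [n nP] := far_apart_size cK (sym_nbhd_nbhs gW).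
pose P k := `[< exists s, [/\ uniq s, {subset s <= K}, far_apart W s &
  size s = k] >].
have P0 : exists k, P k.
  by exists 0%N; apply/asboolP; exists [::]; split.
have Pn k : P k -> (k <= n)%N.
  by move=> /asboolP[s [us sK sepW <-]]; exact: nP.
case: (ex_maxnP P0 Pn) => k /asboolP[s [us sK sepW sk]] kmax.
exists s; split=> // x Kx; apply: contrapT => nx.
have nxs : x \notin s.
  by apply/negP => xs; apply: nx; exists x => //; rewrite subrr; case: gW.
suff : P k.+1 by move/kmax; rewrite ltnn.
apply/asboolP; exists (x :: s); rewrite /= nxs us sk; split=> //.
  by move=> y; rewrite in_cons => /orP[/eqP->|/sK//]; exact: mem_set.
move=> y z; rewrite !inE => /orP[/eqP->|ys] /orP[/eqP->|zs] // Wyz.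
- by exfalso; apply: nx; exists z.
- by exfalso; apply: nx; exists y => //; exact: sym_nbhdN.
- exact: sepW.
Qed.

End GroupTopology.

(** * Haar measure *)

Section HaarMeasure.
Variables (R : realType) (G : lcaGroupType).
Variable theta : {measure set (borel (0 : G)) -> \bar R}.
Hypothesis haar : is_haar theta.
Implicit Types (A K V W U X Y Q : set G) (x y z g h : G) (s : seq G).

Local Notation m X := (fine (theta X)).

Lemma borel_open (T : topologicalType) (x0 : T) (U : set T) :
  open U -> measurable (U : set (borel x0)).
Proof. by move=> oU; exact: sub_sigma_algebra. Qed.

Lemma borel_closed (T : topologicalType) (x0 : T) (U : set T) :
  closed U -> measurable (U : set (borel x0)).
Proof.
move=> cU; rewrite -(setCK U); apply: measurableC; apply: borel_open.
exact: closed_openC.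
Qed.

Lemma borel_compact K : compact K -> measurable (K : set (borel (0 : G))).
Proof. by move=> cK; apply: borel_closed; exact: lca_compact_closed. Qed.

Lemma haar_compact_lty K : compact K -> (theta K < +oo)%E.
Proof. by case: haar => -[h _ _ _]; exact: h. Qed.

Lemma haar_compact_fin K : compact K -> theta K \is a fin_num.
Proof. by move=> cK; rewrite ge0_fin_numE//; exact: haar_compact_lty. Qed.

Lemma shiftsetE A g : shiftset A g = [set x | A (x - g)].
Proof.
apply/seteqP; split=> [_ [a Aa <-]|x Ax] /=; first by rewrite addrK.
by exists (x - g) => //; rewrite subrK.
Qed.

Lemma haar_shift A g : measurable (A : set (borel (0 : G))) ->
  theta (shiftset A g) = theta A.
Proof. by case: haar => _ _; apply. Qed.

Lemma haar_le X Y : measurable (X : set (borel (0 : G))) ->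
  measurable (Y : set (borel (0 : G))) -> X `<=` Y -> (theta X <= theta Y)%E.
Proof. by move=> mX mY XY; apply: le_measure => //; rewrite inE. Qed.

Lemma haar_fine_le X Y : compact X -> compact Y -> X `<=` Y -> m X <= m Y.
Proof.
move=> cX cY XY; apply: fine_le; rewrite ?haar_compact_fin//.
by apply: haar_le => //; exact: borel_compact.
Qed.

Lemma measurable_shift U y : measurable (U : set (borel (0 : G))) ->
  measurable (shiftset U y : set (borel (0 : G))).
Proof.
move=> mU.
have -> : shiftset U y = (fun x => x - y) @^-1` U by exact: shiftsetE.
rewrite -[X in measurable X]setTI.
have : measurable_fun setT ((fun x => x - y) : borel (0 : G) -> borel (0 : G)).
  apply: (@measurability _ _ (borel (0 : G)) (borel (0 : G)) setT _ (@open G)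
    erefl) => _ [V oV <-]; rewrite setTI; apply: borel_open.
  by apply: open_comp oV => z _; exact: addr_continuous.
by apply.
Qed.

Lemma haar_cover X U s : measurable (X : set (borel (0 : G))) ->
  measurable (U : set (borel (0 : G))) ->
  (forall x, X x -> exists2 y, y \in s & U (x - y)) ->
  (theta X <= (size s)%:R%:E * theta U)%E.
Proof.
move=> mX mU; elim: s X mX => [|y s ih] X mX XU.
  rewrite mul0e; have -> : X = set0 by apply/seteqP; split=> // x /XU[].
  by rewrite measure0.
have mU' := measurable_shift y mU.
have mD : measurable (X `\` shiftset U y : set (borel (0 : G))).
  exact: measurableD.
rewrite (@le_trans _ _ (theta (shiftset U y) + theta (X `\` shiftset U y))%E)//.
  rewrite -measureU//; last by rewrite setDE setICA setICr setI0.
  apply: haar_le => //; first exact: measurableU.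
  by move=> x Xx; have [|] := pselect (shiftset U y x); [left|right].
rewrite haar_shift// /= -natr1 addrC EFinD ge0_muleDl ?lee_fin// mul1e.
apply: leeD => //; apply: ih => // x [/XU[z]]; rewrite shiftsetE /= in_cons.
by move=> /orP[/eqP-> //|zs Uz _]; exists z.
Qed.

Lemma haar_pack Y U s : measurable (Y : set (borel (0 : G))) ->
  measurable (U : set (borel (0 : G))) -> uniq s ->
  (forall x, x \in s -> shiftset U x `<=` Y) ->
  (forall x y z, x \in s -> y \in s -> U (z - x) -> U (z - y) -> x = y) ->
  ((size s)%:R%:E * theta U <= theta Y)%E.
Proof.
move=> + mU; elim: s Y => [|y s ih] Y mY; first by rewrite mul0e.
move=> /= /andP[ys us] sY dis.
have mU' := measurable_shift y mU.
have mD : measurable (Y `\` shiftset U y : set (borel (0 : G))).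
  exact: measurableD.
have -> : theta Y = (theta (shiftset U y) + theta (Y `\` shiftset U y))%E.
  rewrite -measureU//; last by rewrite setDE setICA setICr setI0.
  congr (theta _); rewrite setDUK//.
  by apply: sY; exact: mem_head.
rewrite haar_shift// /= -natr1 addrC EFinD ge0_muleDl ?lee_fin// mul1e.
apply: leeD => //; apply: ih => //.
- move=> x xs z zU; split; first by apply: sY zU; rewrite in_cons xs orbT.
  move: zU; rewrite !shiftsetE /= => zx zy; move: ys.
  by rewrite (dis y x z) ?xs// ?mem_head// in_cons xs orbT.
- by move=> x x' z xs x's; apply: dis; rewrite in_cons ?xs ?x's orbT.
Qed.

(** If [U] were null, then every compact set, being covered by finitely many translates of [U],
    would be null, and by inner regularity so would the whole group. *)
Lemma haar_open_gt0 U : open U -> U !=set0 -> (0 < theta U)%E.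
Proof.
move=> oU [u Uu]; rewrite lt0e measure_ge0 andbT; apply/eqP => U0.
case: haar => -[_ inner] nz _; move/eqP: nz; apply; rewrite inner//.
apply/eqP; rewrite eq_le; apply/andP; split.
  apply: ge_ereal_sup => _ [K [cK _] <-].
  have nU : nbhs 0 [set x | U (x + u)].
    apply: open_nbhs_nbhs; split; first exact: open_addr.
    by rewrite /= add0r.
  have [s sP] := compact_finite_cover cK nU.
  have mV : measurable ([set x | U (x + u)] : set (borel (0 : G))).
    by apply: borel_open; exact: open_addr.
  have := haar_cover (borel_compact cK) mV sP.
  have -> : [set x | U (x + u)] = shiftset U (- u).
    by rewrite shiftsetE opprK.
  by rewrite haar_shift ?U0 ?mule0//; exact: borel_open.
apply: ereal_sup_ubound; exists set0; rewrite ?measure0//.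
by split => //; exact: compact0.
Qed.

Lemma haar_sym_nbhd W : sym_nbhd W -> 0 < m W /\ theta W \is a fin_num.
Proof.
move=> [oW W0 _ [K cK WK]]; have gt0 : (0 < theta W)%E.
  by apply: haar_open_gt0 => //; exists 0.
have lty : (theta W < +oo)%E.
  apply: le_lt_trans (haar_compact_lty cK); apply: haar_le => //.
    exact: borel_open.
  exact: borel_compact.
by rewrite ge0_fin_numE// fine_gt0// gt0 lty.
Qed.

(* The translates of a half neighbourhood by points that are far apart are
   disjoint, which bounds their number by a measure. *)
Lemma far_apart_measure W : sym_nbhd W -> exists2 c : R, 0 < c &
  forall s Y, uniq s -> far_apart W s -> compact Y ->
    (forall x v, x \in s -> W v -> Y (x + v)) -> (size s)%:R * c <= m Y.
Proof.
move=> gW; have [U [gU UW UUW]] := sym_nbhd_half (sym_nbhd_nbhs gW).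
have [U0 fU] := haar_sym_nbhd gU; exists (m U) => // s Y us sep cY sY.
rewrite -lee_fin EFinM (fineK fU) (fineK (haar_compact_fin cY)).
apply: haar_pack => //; first exact: borel_compact.
- by apply: borel_open; case: gU.
- move=> x xs _ [u /UW Wu <-]; rewrite addrC; exact: sY.
- move=> x y z xs ys Ux Uy; apply: sep => //.
  exact: UUW (sym_nbhdN gU Ux) Uy.
Qed.

Lemma far_apart_opp W s : sym_nbhd W -> far_apart W s ->
  far_apart W (map -%R s).
Proof.
move=> gW sep _ _ /mapP[x xs ->] /mapP[y ys ->]; rewrite -opprD => Wxy.
by congr (- _); apply: sep => //; case: gW => _ _ /(_ _ Wxy); rewrite opprK.
Qed.

(* A coarse substitute for the inversion invariance of Haar measure. *)
Lemma haar_opp Q : compact Q -> nbhs 0 Q -> exists2 C : R, 0 < C &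
  forall X, compact X -> m X <= C * m (sumset (-%R @` X) Q).
Proof.
move=> cQ nQ; have [W [gW WQ _]] := sym_nbhd_half nQ.
have [c c0 cP] := far_apart_measure gW; have [W0 fW] := haar_sym_nbhd gW.
exists (m W / c); first by rewrite divr_gt0.
move=> X cX; have [s [us sX sep cov]] := maximal_far_apart cX gW.
have := cP (map -%R s) (sumset (-%R @` X) Q).
rewrite map_inj_uniq ?size_map; last exact: oppr_inj.
move=> /(_ us (far_apart_opp gW sep)).
have cXQ : compact (sumset (-%R @` X) Q).
  by apply: compact_sumset => //; exact: compact_opp.
move=> /(_ cXQ) h.
have {}h : (size s)%:R * c <= m (sumset (-%R @` X) Q).
  apply: h => _ v /mapP[x /sX xX ->] /WQ Qv.
  by exists (- x); [exists x => //; exact: set_mem|exists v].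
have : (theta X <= (size s)%:R%:E * theta W)%E.
  by apply: haar_cover => //; [exact: borel_compact|apply: borel_open;
    case: gW].
rewrite -(fineK (haar_compact_fin cX)) -(fineK fW) -EFinM lee_fin.
move=> /le_trans; apply; rewrite mulrAC ler_pdivlMr// mulrAC mulrC.
by rewrite ler_wpM2l// ltW.
Qed.

End HaarMeasure.

(** * Van Hove sequences *)

Section VanHove.
Variables (R : realType) (G : lcaGroupType).
Variable theta : {measure set (borel (0 : G)) -> \bar R}.
Hypothesis haar : is_haar theta.
Implicit Types (K L Q X Y Z : set G) (x y z g h : G).

Local Notation m X := (fine (theta X)).

Lemma compact_boundary K X : compact K -> compact X ->
  compact (van_hove_boundary K X).
Proof.
move=> cK cX; apply: (subclosed_compact _ (compact_sumset cK cX)).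
  apply: closedI; last exact: closed_closure.
  by apply: lca_compact_closed; exact: compact_sumset.
by move=> x [].
Qed.

(** As 0 lies in [Z], a point of [Z + A n] outside [A n] belongs to the boundary with respect to
    [Z], and this boundary is eventually no larger than [A n]. *)
Lemma van_hove_thickening (A : nat -> set G) Z : van_hove theta A ->
  compact Z -> Z 0 -> \forall n \near \oo, m (sumset Z (A n)) <= 2 * m (A n).
Proof.
move=> [cA A0 lim] cZ Z0; have /cvgrPdist_lt/(_ 1 ltr01) := lim Z cZ.
apply: filterS => n; rewrite sub0r normrN => h.
have An0 : 0 < m (A n) by rewrite fine_gt0// A0 haar_compact_lty.
have {h} : m (van_hove_boundary Z (A n)) <= m (A n).
  rewrite -[leRHS]mul1r -ler_pdivrMr// ltW// (le_lt_trans _ h)//.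
  by rewrite ler_norm.
have cB := compact_boundary cZ (cA n); have cZA := compact_sumset cZ (cA n).
move=> bnd; rewrite (@le_trans _ _ (m (A n) + m (van_hove_boundary Z (A n))))//.
  rewrite -fineD ?(haar_compact_fin haar)//.
  apply: fine_le; first exact: haar_compact_fin.
    by rewrite fin_numD !(haar_compact_fin haar).
  rewrite (le_trans _ (measureU2 _ _ _))//; try exact: borel_compact.
  apply: haar_le; [exact: borel_compact| |].
    by apply: measurableU; exact: borel_compact.
  move=> x Zx; have [|nAx] := pselect (A n x); [by left|right; split=> //].
  by apply: subset_closure; exists 0 => //; exists x; rewrite ?add0r.
by rewrite mulr_natl mulr2n lerD2l.
Qed.

(** This is the window [Q - X + h]. For [h = 0] it consists of the points that a translation by some
    element of [X] moves into [Q]. *)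
Definition reflected Q X h : set G :=
  shiftset (sumset Q (-%R @` X)) h.

Lemma reflectedP Q X h x :
  reflected Q X h x <-> exists q a, [/\ Q q, X a & x = q - a + h].
Proof.
split=> [[_ [q Qq [_ [a Xa <-] <-]] <-]|[q [a [Qq Xa ->]]]].
  by exists q, a.
by exists (q - a) => //; exists q => //; exists (- a) => //; exists a.
Qed.

Lemma compact_reflected Q X h : compact Q -> compact X ->
  compact (reflected Q X h).
Proof.
move=> cQ cX; apply: compact_shift; apply: compact_sumset => //.
exact: compact_opp.
Qed.

Lemma haar_reflected Q X h : compact Q -> compact X ->
  theta (reflected Q X h) = theta (sumset Q (-%R @` X)).
Proof.
move=> cQ cX; apply: haar_shift => //; apply: borel_compact.
by apply: compact_sumset => //; exact: compact_opp.
Qed.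

Lemma sumsetC X Y : sumset X Y = sumset Y X.
Proof.
by apply/seteqP; split=> _ [x ? [y ? <-]]; exists y => //; exists x => //;
  rewrite addrC.
Qed.

(** The reflection [x |-> h - x] is a homeomorphism. It carries [Q - X + h] to [X - Q], and the
    extra [Q] is absorbed into the compact set that defines the boundary. *)
Lemma boundary_reflected K Q X h x : Q 0 ->
  van_hove_boundary K (reflected Q X h) x ->
  van_hove_boundary (-%R @` sumset K Q) X (h - x).
Proof.
move=> Q0 [[k Kk [r /reflectedP[q [a [Qq Xa ->]]] <-]] clx]; split.
  exists (- (k + q)); first by exists (k + q) => //; exists k => //; exists q.
  by exists a => //; zmod.
move=> N nN; have := clx _ (@subl_continuous G h (k + (q - a + h)) N nN).
move=> [_ [[k' Kk' [r' nr <-]] Nr]]; exists (h - (k' + r')); split=> //.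
exists (- k'); first by exists k' => //; exists k' => //; exists 0;
  rewrite ?addr0.
exists (h - r'); last by zmod.
move=> Xhr; apply: nr; apply/reflectedP; exists 0, (h - r'); split=> //.
zmod.
Qed.

Lemma boundary_add L Q X x q : Q q -> van_hove_boundary L X x ->
  van_hove_boundary (sumset L Q) X (x + q).
Proof.
move=> Qq [[l Ll [a Xa <-]] clx]; split.
  by exists (l + q); [exists l => //; exists q|exists a; rewrite // addrAC].
move=> N nN;
  have [_ [[l' Ll' [r nr <-]] Nr]] := clx _ (@addr_continuous G q _ N nN).
exists (l' + r + q); split=> //; exists (l' + q); first by exists l' => //;
  exists q.
by exists r => //; rewrite addrAC.
Qed.

(** Up to a shift, the boundary of the window lies in the negative of a boundary of [X]. Undoing the
    inversion by [haar_opp] costs a factor and a thickening by [Q], which again only enlarges the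
    compact set. *)
Lemma haar_boundary_reflected Q : compact Q -> nbhs 0 Q ->
  exists2 C : R, 0 < C & forall K X h, compact K -> compact X ->
    m (van_hove_boundary K (reflected Q X h)) <=
      C * m (van_hove_boundary (sumset (-%R @` sumset K Q) Q) X).
Proof.
move=> cQ nQ; have [C C0 CP] := haar_opp haar cQ nQ; exists C => //.
move=> K X h cK cX; set L := -%R @` sumset K Q.
have cL : compact L by apply: compact_opp; exact: compact_sumset.
have cB := compact_boundary cL cX.
have cB' : compact (-%R @` van_hove_boundary L X) by exact: compact_opp.
have cR := compact_boundary cK (compact_reflected (h := h) cQ cX).
have le1 : m (van_hove_boundary K (reflected Q X h)) <=
    m (-%R @` van_hove_boundary L X).
  rewrite -[leRHS](congr1 fine (haar_shift haar h (borel_compact cB'))).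
  apply: haar_fine_le => //; first exact: compact_shift.
  move=> x /(boundary_reflected (nbhs_singleton nQ)) Bx.
  exists (x - h); last by rewrite subrK.
  by exists (h - x) => //; rewrite opprB.
apply: (le_trans le1); apply: (le_trans (CP _ cB')).
rewrite ler_pM2l//; apply: haar_fine_le => //.
- by apply: compact_sumset => //; exact: compact_opp.
- by apply: compact_boundary => //; exact: compact_sumset.
move=> _ [_ [_ [y By <-] <-] [q Qq <-]]; rewrite opprK.
exact: boundary_add.
Qed.

(** The shifts [h n] are arbitrary; this freedom later yields bounds that are uniform over all
    translates of [omega]. Boundaries are controlled by [haar_boundary_reflected], and [haar_opp]
    bounds the measure of the windows from below. *)
Lemma reflected_van_hove (A : nat -> set G) Q (h : nat -> G) :
  van_hove theta A -> compact Q -> nbhs 0 Q ->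
  van_hove theta (fun n => reflected Q (A n) (h n)).
Proof.
move=> [cA A0 lim] cQ nQ.
have mA n : 0 < m (A n) by rewrite fine_gt0// A0 haar_compact_lty.
have cR n : compact (reflected Q (A n) (h n)) by exact: compact_reflected.
have [C C0 CP] := haar_boundary_reflected cQ nQ.
have [C' C'0 C'P] := haar_opp haar cQ nQ.
have leA n : m (A n) <= C' * m (reflected Q (A n) (h n)).
  by rewrite haar_reflected// sumsetC; exact: C'P.
have R0 n : 0 < m (reflected Q (A n) (h n)).
  by rewrite -(pmulr_rgt0 _ C'0); exact: lt_le_trans (leA n).
split=> // [n|K cK].
  by rewrite -(fineK (haar_compact_fin haar (cR n))) lte_fin.
have := lim _ (compact_sumset (compact_opp (compact_sumset cK cQ)) cQ).
move=> /cvgrPdist_lt h0; apply/cvgrPdist_lt => e e0.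
have e'0 : 0 < e / (C * C') by rewrite divr_gt0// mulr_gt0.
have := h0 _ e'0; apply: filterS => n; rewrite !sub0r !normrN.
set B := m _; set D := m (van_hove_boundary K _) => h1.
have B0 : 0 <= B by apply: fine_ge0.
have D0 : 0 <= D by apply: fine_ge0.
have {}h1 : B < e / (C * C') * m (A n).
  by rewrite -ltr_pdivrMr// (le_lt_trans _ h1)// ler_norm.
rewrite ger0_norm; last by rewrite divr_ge0// ltW.
rewrite ltr_pdivrMr//; apply: le_lt_trans (CP K (A n) (h n) cK (cA n)) _.
rewrite -/B mulrC -ltr_pdivlMr//; apply: lt_le_trans h1 _.
have -> : e * m (reflected Q (A n) (h n)) / C =
    e / (C * C') * (C' * m (reflected Q (A n) (h n))).
  by field; rewrite !gt_eqF.
by rewrite ler_pM2l.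
Qed.

(** The point is that [C] is chosen before [L]: [haar_opp] with the fixed set [Q] turns [L - A n]
    into a thickening of [A n], whose measure is eventually at most twice that of [A n]. *)
Lemma reflected_haar_le (A : nat -> set G) Q : van_hove theta A ->
  compact Q -> nbhs 0 Q -> exists2 C : R, 0 < C &
    forall L, compact L -> \forall n \near \oo, forall h,
      m (reflected L (A n) h) <= C * m (A n).
Proof.
move=> vA cQ nQ; have [C C0 CP] := haar_opp haar cQ nQ.
exists (C * 2); rewrite ?mulr_gt0// => L cL.
have [cA A0 _] := vA; have Q0 := nbhs_singleton nQ.
pose Z := sumset (-%R @` (L `|` [set 0])) Q.
have cZ : compact Z.
  by apply: compact_sumset => //; apply: compact_opp; apply: compactU => //;
     exact: compact_set1.
have Z0 : Z 0 by exists 0; [exists 0; rewrite ?oppr0//; right|exists 0;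
  rewrite ?addr0].
have := van_hove_thickening vA cZ Z0; apply: filterS => n le2 h.
rewrite haar_reflected//.
have cLA : compact (sumset L (-%R @` A n)).
  by apply: compact_sumset => //; exact: compact_opp.
apply: (le_trans (CP _ cLA)); rewrite -mulrA ler_pM2l//.
apply: le_trans le2; apply: haar_fine_le => //.
- by apply: compact_sumset => //; exact: compact_opp.
- exact: compact_sumset.
move=> _ [_ [_ [l Ll [_ [a Aa <-] <-]] <-] [q Qq <-]].
exists (- l + q); first by exists (- l) => //; [exists l => //; left|exists q].
by exists a => //; rewrite opprD opprK addrAC.
Qed.

End VanHove.

(** * Correlations of compactly supported functions *)

Section CompactlySupported.
Variables (R : realType) (G : lcaGroupType).
Variable theta : {measure set (borel (0 : G)) -> \bar R}.
Hypothesis haar : is_haar theta.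
Implicit Types (S : set G) (f a b : G -> R) (g t x y : G).

Definition csupp S f :=
  [/\ continuous f, compact S & forall x, ~ S x -> f x = 0].

Lemma continuous_borel (T : topologicalType) (x0 : T) (f : T -> R) :
  continuous f -> measurable_fun setT (f : borel x0 -> R).
Proof.
move=> cf; apply: (measurability _ (RGenOpens.measurableE R)).
move=> _ [_ [a [b ->] <-]]; rewrite setTI; apply: borel_open.
by apply: open_comp => [x _|]; [exact: cf|exact: interval_open].
Qed.

Lemma csupp_bounded S f : csupp S f -> exists2 M, 0 < M & forall x, `|f x| <= M.
Proof.
move=> [cf cS f0].
have : compact (f @` S) by apply: continuous_compact => //;
  exact: continuous_subspaceT.
move=> /compact_bounded[M [_ MP]].
exists (`|M| + 1) => [|x]; first by rewrite ltr_pwDr.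
have [Sx|/f0->] := pselect (S x); last by rewrite normr0 addr_ge0.
apply: (MP (`|M| + 1)); first by rewrite (le_lt_trans (ler_norm M))// ltrDl.
by exists x.
Qed.

Lemma bounded_supp_integrable S (f : G -> R) M : compact S ->
  measurable_fun setT (f : borel (0 : G) -> R) ->
  (forall x, `|f x| <= M) -> (forall x, ~ S x -> f x = 0) ->
  theta.-integrable setT (EFin \o (f : borel (0 : G) -> R)).
Proof.
move=> cS mf fM f0; have mS := borel_compact cS.
apply: (@le_integrable _ _ _ _ _ measurableT _
  (EFin \o (fun x : borel (0 : G) => M * (\1_S x : R)))).
- exact: measurableT_comp.
- move=> x _ /=; rewrite lee_fin indicE.
  have [Sx|nSx] := boolP (x \in (S : set (borel (0 : G)))).
    by rewrite mulr1 (le_trans (fM x))// ler_norm.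
  by rewrite mulr0 f0 ?normr0//; move: nSx; rewrite notin_setE.
- apply: (@eq_integrable _ _ _ _ _ measurableT
     (fun x : borel (0 : G) => (M%:E * (\1_S x)%:E)%E)) => //.
  apply: integrableZl => //.
  apply/integrableP; split; first exact/measurable_EFinP.
  rewrite (eq_integral (fun x : borel (0 : G) => (\1_S x : R)%:E)); last first.
    by move=> x _; rewrite gee0_abs// lee_fin.
  by rewrite integral_indic// setIT; exact: haar_compact_lty.
Qed.

Lemma csupp_integrable S f : csupp S f ->
  theta.-integrable setT (EFin \o (f : borel (0 : G) -> R)).
Proof.
move=> sf; have [M _ MP] := csupp_bounded sf; case: sf => cf cS f0.
by apply: (bounded_supp_integrable cS _ MP f0); exact: continuous_borel.
Qed.

Lemma measurable_addr g :
  measurable_fun setT ((fun x => x + g) : borel (0 : G) -> borel (0 : G)).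
Proof.
apply: (@measurability _ _ (borel (0 : G)) (borel (0 : G)) setT _ (@open G)
  erefl).
move=> _ [V oV <-]; rewrite setTI; apply: borel_open.
by apply: open_comp oV => z _; exact: addr_continuous.
Qed.

Lemma pushforward_addr g (A : set (borel (0 : G))) : measurable A ->
  pushforward theta ((fun x => x + g) : borel (0 : G) -> borel (0 : G)) A =
    theta A.
Proof.
move=> mA; rewrite /pushforward -[RHS](haar_shift haar (- g))// shiftsetE.
by congr (theta _); apply/seteqP; split=> x /=; rewrite opprK.
Qed.

Lemma csupp_shift S f t : csupp S f ->
  csupp (shiftset S t) (fun x => f (x - t)).
Proof.
move=> [cf cS f0]; split; last 2 first.
- exact: compact_shift.
- by move=> x; rewrite shiftsetE => /f0.
by move=> x; apply: continuous_comp; [exact: addr_continuous|exact: cf].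
Qed.

Lemma integrable_shift (f : G -> R) g :
  theta.-integrable setT (EFin \o (f : borel (0 : G) -> R)) ->
  theta.-integrable setT (EFin \o ((fun x => f (x + g)) : borel (0 : G) -> R)).
Proof.
move=> fi; have := fi => /integrableP[mf]; rewrite /= => fi'.
have mf' : measurable_fun setT (f : borel (0 : G) -> R) by
  exact/measurable_EFinP.
apply/integrableP; split.
  apply/measurable_EFinP.
  exact: (measurableT_comp mf' (measurable_addr g)).
have mn : measurable_fun setT (fun x : borel (0 : G) => `|(f x)%:E|%E).
  by apply: measurableT_comp mf; exact: abse_measurable.
have := @ge0_integral_pushforward _ _ _ _ R _ (measurable_addr g) theta setT
  (fun x : borel (0 : G) => `|(f x)%:E|%E) measurableT mn.
rewrite /= preimage_setT => <- //.
rewrite (le_lt_trans _ fi')// le_eqVlt; apply/orP; left; apply/eqP.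
apply: eq_measure_integral => [|? A mA _]; first exact: measurable_addr.
exact: pushforward_addr.
Qed.

Lemma Rintegral_shift (f : G -> R) g :
  theta.-integrable setT (EFin \o (f : borel (0 : G) -> R)) ->
  \int[theta]_x f (x + g) = \int[theta]_x f x.
Proof.
move=> fi; rewrite /Rintegral; congr fine.
have /integrableP[mf _] := fi.
have := @integral_pushforward _ _ _ _ R _ (measurable_addr g) theta setT
  (EFin \o f) mf (integrable_shift g fi) measurableT.
rewrite preimage_setT /= => <-.
apply: eq_measure_integral => [|? A mA _]; first exact: measurable_addr.
exact: pushforward_addr.
Qed.

Lemma csuppM S S' f f' : csupp S f -> csupp S' f' ->
  csupp S (fun x => f x * f' x).
Proof.
move=> [cf cS f0] [cf' _ _]; split=> // [x|x /f0->]; last by rewrite mul0r.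
by apply: continuousM; [exact: cf|exact: cf'].
Qed.

Lemma csuppB S S' f f' : csupp S f -> csupp S' f' ->
  csupp (S `|` S') (fun x => f x - f' x).
Proof.
move=> [cf cS f0] [cf' cS' f'0]; split=> [x||x nS].
- by apply: continuousB; [exact: cf|exact: cf'].
- exact: compactU.
- by rewrite f0 ?f'0 ?subr0// => Sx; apply: nS; by [left|right].
Qed.

(** The convolution of [a] with the reflection of [b], that is, [a * b~] for real functions. *)
Definition corr a b y := \int[theta]_x (a x * b (x - y)).

Lemma corr_integrable S S' a b y : csupp S a -> csupp S' b ->
  theta.-integrable setT
    (EFin \o ((fun x => a x * b (x - y)) : borel (0 : G) -> R)).
Proof.
move=> sa sb; apply: (@csupp_integrable S).
exact: csuppM (csupp_shift y sb).
Qed.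

Lemma corr_shiftl S S' a b t y : csupp S a -> csupp S' b ->
  corr (fun x => a (x - t)) b y = corr a b (y - t).
Proof.
move=> sa sb; rewrite /corr -[LHS](Rintegral_shift t); last first.
  exact: corr_integrable (csupp_shift t sa) sb.
apply: eq_Rintegral => x _; congr (a _ * b _); zmod.
Qed.

Lemma corr_shiftr a b t y :
  corr a (fun x => b (x - t)) y = corr a b (y + t).
Proof.
apply: eq_Rintegral => x _; congr (a _ * b _); zmod.
Qed.

Lemma corrC S S' a b y : csupp S a -> csupp S' b ->
  corr a b (- y) = corr b a y.
Proof.
move=> sa sb; rewrite /corr -[RHS](Rintegral_shift y); last first.
  exact: corr_integrable sb sa.
by apply: eq_Rintegral => x _; rewrite mulrC addrK opprK.
Qed.

(** Bilinearity and the shift rules express [D * D~] as a negative second difference of [f * f~],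
    which makes its sums over pairs of points countable. *)
Lemma corr_diff S f t y : csupp S f ->
  let D x := f x - f (x - t) in
  corr D D y = 2 * corr f f y - corr f f (y - t) - corr f f (y + t).
Proof.
move=> sf D; have st := csupp_shift t sf.
have sD : csupp _ D := csuppB sf st.
have -> : corr D D y = corr f D y - corr (fun x => f (x - t)) D y.
  rewrite /corr -RintegralB//; last 2 first.
  - exact: corr_integrable sf sD.
  - exact: corr_integrable st sD.
  by apply: eq_Rintegral => x _; rewrite mulrBl.
have hB S' a : csupp S' a ->
    corr a D y = corr a f y - corr a (fun x => f (x - t)) y.
  move=> sa; rewrite /corr -RintegralB//; last 2 first.
  - exact: corr_integrable sa sf.
  - exact: corr_integrable sa st.
  by apply: eq_Rintegral => x _; rewrite mulrBr.
rewrite (hB _ _ sf) (hB _ _ st) corr_shiftr (corr_shiftl _ _ sf sf).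
rewrite (corr_shiftl _ _ sf st) corr_shiftr subrK.
by rewrite mulr_natl mulr2n; ring.
Qed.

(** Integrate [2 a b <= a ^ 2 + b ^ 2] and use the translation invariance of the integral of the
    square of [f]. *)
Lemma corr_le S f y : csupp S f -> corr f f y <= corr f f 0.
Proof.
move=> sf; rewrite -(@ler_pM2l _ 2)//.
have sq : csupp S (fun x => f x * f x) by exact: (csuppM sf sf).
have e1 : corr f f 0 = \int[theta]_x (f x * f x).
  by apply: eq_Rintegral => x _; rewrite subr0.
have e2 : corr f f 0 = \int[theta]_x (f (x - y) * f (x - y)).
  by rewrite e1 -[RHS]/(\int[theta]_x (fun x => f x * f x) (x - y))
    (Rintegral_shift _ (csupp_integrable sq)).
have -> : 2 * corr f f 0 =
    \int[theta]_x (f x * f x + f (x - y) * f (x - y)).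
  rewrite RintegralD//; last 2 first.
  - exact: csupp_integrable sq.
  - exact: csupp_integrable (csupp_shift y sq).
  by rewrite -e1 -e2 mulr_natl mulr2n.
have ci := corr_integrable y sf sf.
rewrite /corr -RintegralZl//; apply: le_Rintegral => //.
- by have := integrableZl measurableT 2 ci; apply: eq_integrable.
- have := integrableD measurableT (csupp_integrable sq)
    (csupp_integrable (csupp_shift y sq)).
  exact: eq_integrable.
- move=> x _; rewrite -subr_ge0.
  have -> : f x * f x + f (x - y) * f (x - y) - 2 * (f x * f (x - y)) =
    (f x - f (x - y)) ^+ 2 by ring.
  exact: sqr_ge0.
Qed.

Lemma corr_eq0 (P : set G) f y : (forall x, ~ P x -> f x = 0) ->
  (forall x, P x -> ~ P (x - y)) -> corr f f y = 0.
Proof.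
move=> f0 Py; rewrite /corr.
transitivity (\int[theta]_x ((fun=> 0) : borel (0 : G) -> R) x).
  apply: eq_Rintegral => x _.
  have [Px|/f0->] := pselect (P x); last by rewrite mul0r.
  by rewrite (f0 (x - y)) ?mulr0//; exact: Py.
by rewrite Rintegral_cst// mul0r.
Qed.

(** On the open set [U] where the absolute value of [f] exceeds half of its value at 0, the
    integrand is at least [e ^+ 2], and [U] has positive measure. *)
Lemma corr_gt0 S f : csupp S f -> f 0 != 0 -> 0 < corr f f 0.
Proof.
move=> sf f0; have [cf cS fS] := sf.
have sq : csupp S (fun x => f x * f x) by exact: (csuppM sf sf).
pose e := `|f 0| / 2; have e0 : 0 < e by rewrite divr_gt0// normr_gt0.
pose U := [set x | e < `|f x|].
have oU : open U.
  have -> : U = (fun x => `|f x|) @^-1` [set r | e < r] by [].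
  apply: open_comp; last exact: open_gt.
  by move=> x _; apply: continuous_comp; [exact: cf|exact: norm_continuous].
have U0 : U 0 by rewrite /U /= /e ltr_pdivrMr// ltr_pMr ?normr_gt0// ltr1n.
have US : U `<=` S.
  move=> x Ux; apply: contrapT => /fS fx0; move: Ux.
  by rewrite /U /= fx0 normr0 ltNge (ltW e0).
have mU : measurable (U : set (borel (0 : G))) by exact: borel_open.
have tU0 : (0 < theta U)%E by apply: haar_open_gt0 => //; exists 0.
have tUlty : (theta U < +oo)%E.
  apply: le_lt_trans (haar_compact_lty haar cS); apply: haar_le => //.
  exact: borel_compact.
apply: (@lt_le_trans _ _ (e ^+ 2 * fine (theta U))).
  by rewrite mulr_gt0 ?exprn_gt0// fine_gt0// tU0.
have -> : corr f f 0 = \int[theta]_x (f x * f x).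
  by apply: eq_Rintegral => x _; rewrite subr0.
rewrite -(Rintegral_cst theta mU) Rintegral_mkcond.
apply: le_Rintegral => //.
- apply: (@bounded_supp_integrable S _ (e ^+ 2)) => //.
  + apply/(measurable_restrictT _ mU); exact: measurable_cst.
  + move=> x; rewrite patchE; case: ifP => _.
      by rewrite ger0_norm// sqr_ge0.
    by rewrite normr0 sqr_ge0.
  + by move=> x nSx; rewrite patchE memNset// => /US.
- exact: csupp_integrable sq.
move=> x _; rewrite patchE; case: ifPn => [|_]; last exact: sqr_ge0.
rewrite inE => Ux; rewrite -expr2 -[leRHS]real_normK ?num_real//.
by rewrite ler_sqr ?nnegrE ?normr_ge0 ?(ltW e0)//; exact: ltW.
Qed.

Lemma corr_continuous S S' a b : csupp S a -> csupp S' b ->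
  continuous (corr a b).
Proof.
move=> sa sb y0; have [M M0 MP] := csupp_bounded sa.
have [ca cS a0] := sa; have [cb cS' b0] := sb.
apply/cvgrPdist_le => e e0.
(* A deviation of at most [d] on [S] changes the integral by at most [M * d * theta S <= e]; the
   summand 1 keeps the denominator positive. *)
pose d := e / (M * (fine (theta S) + 1)).
have tS0 : 0 < fine (theta S) + 1 by rewrite ltr_wpDl.
have d0 : 0 < d by rewrite divr_gt0// mulr_gt0.
have /compact_near_coveringP nS := cS.
have : \forall y \near y0, S `<=` [set x | `|b (x - y0) - b (x - y)| < d].
  apply: (nS _ (nbhs y0) (fun y x => `|b (x - y0) - b (x - y)| < d)).
  move=> x Sx.
  have cc : {for (x, y0),
      continuous (fun p : G * G => `|b (p.1 - y0) - b (p.1 - p.2)|)}.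
    have c1 : {for (x, y0), continuous (fun p : G * G => b (p.1 - y0))}.
      apply: (@continuous_comp _ _ _ (fun p : G * G => p.1 - y0) b);
        last exact: cb.
      apply: (@continuous_comp _ _ _ (fun p : G * G => p.1) (fun z => z - y0)).
        exact: cvg_fst.
      exact: addr_continuous.
    have c2 : {for (x, y0), continuous (fun p : G * G => b (p.1 - p.2))}.
      apply: (@continuous_comp _ _ _ (fun p : G * G => p.1 - p.2) b);
        last exact: cb.
      exact: sub_continuous.
    apply: (@continuous_comp _ _ _
      (fun p : G * G => b (p.1 - y0) - b (p.1 - p.2)) (fun r : R => `|r|)).
      exact: continuousB c1 c2.
    exact: norm_continuous.
  have := cc [set r : R | r < d]; apply.
  rewrite subrr normr0; apply: open_nbhs_nbhs; split => //; exact: open_lt.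
apply: filterS => y Sy; rewrite /corr -RintegralB//; last 2 first.
- exact: corr_integrable sa sb.
- exact: corr_integrable sa sb.
have mS := borel_compact cS.
have iB : theta.-integrable setT (EFin \o ((fun x => a x * b (x - y0) - a x * b
  (x - y)) : borel (0 : G) -> R)).
  have := integrableB measurableT (corr_integrable y0 sa sb) (corr_integrable y
    sa sb).
  exact: eq_integrable.
apply: (le_trans (le_normr_Rintegral measurableT iB)).
apply: (@le_trans _ _ (\int[theta]_x (((fun=> M * d) : borel (0 : G) -> R) \_
  S) x)).
  apply: le_Rintegral => //.
  - by have := integrable_norm iB; exact: eq_integrable.
  - apply: (@bounded_supp_integrable S _ (M * d)) => //.
    + apply/(measurable_restrictT _ mS); exact: measurable_cst.
    + have Md : 0 <= M * d by rewrite mulr_ge0// ltW.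
      by move=> x; rewrite patchE; case: ifP => _; rewrite ?normr0// ger0_norm.
    + by move=> x nSx; rewrite patchE memNset.
  - move=> x _; rewrite patchE; case: ifPn => [|nS'].
      rewrite inE => Sx; rewrite -mulrBr normrM ler_pM//.
      by have := Sy x Sx; exact: ltW.
    by rewrite a0 ?mul0r ?subrr ?normr0// => Sx; move/negP: nS'; apply;
      rewrite inE.
rewrite -Rintegral_mkcond Rintegral_cst// /d.
have -> : M * (e / (M * (fine (theta S) + 1))) * fine (theta S) =
  e * (fine (theta S) / (fine (theta S) + 1)).
  by field; rewrite !gt_eqF.
by rewrite ler_piMr ?(ltW e0)// ler_pdivrMr// mul1r lerDl.
Qed.

End CompactlySupported.

(** * Pure point measures *)

Section PurePoint.
Variables (R : realType) (T : topologicalType) (x0 : T).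
Variable mu : {measure set (borel x0) -> \bar R}.
Hypothesis mu_pp : is_pure_point mu.
Hypothesis measurable_point :
  forall x : T, measurable ([set x] : set (borel x0)).
Variables (w : borel x0 -> R) (M : R).
Hypothesis w_int : mu.-integrable setT (EFin \o w).
Hypothesis w_ge0 : forall x, 0 <= w x.
Hypothesis w_leM : forall x, w x <= M.
Local Open Scope ereal_scope.

Let measurable_finite (F : set (borel x0)) : finite_set F -> measurable F.
Proof.
move=> finF; rewrite -(image_id F) -bigcup_imset1.
by apply: fin_bigcup_measurable => // x _; exact: measurable_point.
Qed.

Let w_meas : measurable_fun setT w.
Proof. by apply/measurable_EFinP; case/integrableP: w_int. Qed.

Let level n : set (borel x0) := [set x | (n.+1%:R^-1 < w x)%R].

Let measurable_level n : measurable (level n).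
Proof.
rewrite -[level n]setTI;
  have -> : level n = w @^-1` [set` `](n.+1%:R^-1)%R, +oo[%R].
  by apply/seteqP; split=> x /=; rewrite /level /= in_itv/= andbT.
exact: w_meas.
Qed.

Let off_level_cvg : \int[mu]_(x in ~` level n) (w x)%:E @[n --> \oo] --> 0.
Proof.
pose f_ n : borel x0 -> \bar R := (EFin \o w) \_ (~` level n).
have -> : (fun n => \int[mu]_(x in ~` level n) (w x)%:E) =
    (fun n => \int[mu]_x f_ n x).
  by apply/funext => n; rewrite integral_mkcond.
have mf n : measurable_fun setT (f_ n).
  apply/(measurable_restrictT _ (measurableC (measurable_level n))).
  exact: measurable_funTS (measurableT_comp (@EFin_measurable _ _) w_meas).
have -> : 0 = \int[mu]_x (cst 0 : borel x0 -> \bar R) x by rewrite integral0.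
apply: (@dominated_cvg _ _ _ mu setT measurableT f_ (cst 0) (EFin \o w)) => //.
- move=> x _; have [w0|w0] := eqVneq (w x) 0%R.
    rewrite (_ : (fun n => f_ n x) = cst 0); first exact: cvg_cst.
    by apply/funext => n; rewrite /f_ patchE /= w0; case: ifP.
  have wgt0 : (0 < w x)%R by rewrite lt_def w0 w_ge0.
  apply: cvg_near_cst; have := near_infty_natSinv_lt (PosNum wgt0).
  by apply: filterS => n /= h; rewrite /f_ patchE memNset//=.
- move=> n x _; rewrite /f_ patchE; case: ifP => _ /=.
    by rewrite lee_fin ger0_norm.
  by rewrite normr0 lee_fin.
Qed.

Let level_lty n : mu (level n) < +oo.
Proof.
have [_ wlty] := integrableP _ _ _ w_int.
have : n.+1%:R^-1%:E * mu (level n) <= \int[mu]_x `|(EFin \o w) x|.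
  rewrite -(integral_cst mu (measurable_level n)) integral_mkcond.
  apply: ge0_le_integral => //.
  - by move=> x _; rewrite patchE; case: ifP => //; rewrite lee_fin.
  - by apply/(measurable_restrictT _ (measurable_level n));
    exact: measurable_cst.
  - apply: (measurableT_comp (@abse_measurable _ _)).
    exact: (measurableT_comp (@EFin_measurable _ _) w_meas).
  - move=> x _; rewrite patchE; case: ifPn => [|_]; last exact: abse_ge0.
    by rewrite inE /level /= => h; rewrite lee_fin ger0_norm// ltW.
move=> /le_lt_trans/(_ wlty); apply: contraPP => /negP.
by rewrite -leNgt leye_eq => /eqP->; rewrite gt0_muley// lte_fin.
Qed.

(** By dominated convergence, little of the integral of [w] lies off a level set [1 / (n + 1) < w].
    That level set has finite measure by Markov's inequality, so finitely many atoms carry it up to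
    [e'], and the rest contributes at most [M * e']. *)
Lemma pure_point_concentrated (e : R) : (0 < e)%R ->
  exists F : {fset T}, \int[mu]_(x in ~` [set` F]) (w x)%:E <= e%:E.
Proof.
move=> e0; have e20 : (0 < e / 2)%R by rewrite divr_gt0.
have /fine_cvgP[fin cvg] := off_level_cvg.
have [n [finn] ltn] : exists n, \int[mu]_(x in ~` level n) (w x)%:E \is a
  fin_num
    /\ (fine (\int[mu]_(x in ~` level n) (w x)%:E) < e / 2)%R.
  near \oo => n; exists n; split; first by near: n; exact: fin.
  have : (`|0 - fine (\int[mu]_(x in ~` level n) (w x)%:E)| < e / 2)%R.
    by near: n; move/cvgrPdist_lt : cvg; apply.
  by rewrite sub0r normrN; apply: le_lt_trans; exact: ler_norm.
have M0 : (0 <= M)%R := le_trans (w_ge0 x0) (w_leM x0).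
pose e' := (e / 2 / (M + 1))%R.
have e'0 : (0 < e')%R by rewrite divr_gt0// ltr_wpDl.
have flevel : mu (level n) \is a fin_num by rewrite ge0_fin_numE.
have : mu (level n) - e'%:E < mu (level n) by rewrite lteBlDr// lteDl// lte_fin.
(* The sum over all atoms is a supremum over finite sets of atoms, one of which comes within [e'] of
   it. *)
rewrite {2}(mu_pp (measurable_level n)) => /ereal_sup_gt[_ [F [finF Fsub] <-]]
  ltF.
have mF : measurable (F : set (borel x0)).
  exact: measurable_finite.
have muF : mu F = \sum_(x \in F) mu [set x].
  rewrite -measure_fin_bigcup//; first by rewrite bigcup_imset1 image_id.
  by apply/trivIsetP => i j _ _ ij; apply/seteqP; split=> // x [/= -> /eqP];
     rewrite (negPf ij).
have mLF : measurable (level n `\` F) by exact: measurableD.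
have small : mu (level n `\` F) <= e'%:E.
  rewrite measureD//; last exact: level_lty.
  rewrite setIidr// [X in _ - X]muF leeBlDr.
    by rewrite addeC -leeBlDr// ltW.
  by rewrite -muF ge0_fin_numE//; apply: le_lt_trans (level_lty n);
    apply: le_measure; rewrite ?inE.
have [G GF] := finite_fsetP.1 finF; exists G; rewrite -GF.
have -> : ~` F = ~` level n `|` (level n `\` F).
  apply/seteqP; split=> x /=.
    by move=> nF; have [|] := pselect (level n x); [right|left].
  by move=> [nl Fx|[]//]; apply: nl; exact: Fsub.
have mw D : measurable_fun D (fun x => (w x)%:E).
  exact: measurable_funTS (measurableT_comp (@EFin_measurable _ _) w_meas).
rewrite ge0_integral_setU//; last 3 first.
- exact: measurableC.
- by move=> x _; rewrite lee_fin.
- by apply/disj_setPS => x [/= nl [l _]]; exact: nl.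
rewrite [e]splitr EFinD; apply: leeD.
  by rewrite -(fineK finn) lee_fin ltW.
apply: (@le_trans _ _ (\int[mu]_(x in level n `\` F) (cst M%:E) x)).
  apply: ge0_le_integral => //.
  - by move=> x _; rewrite lee_fin.
  - by move=> x _; rewrite lee_fin.
rewrite integral_cst//; apply: (@le_trans _ _ (M%:E * e'%:E)).
  by rewrite lee_wpmul2l// lee_fin.
rewrite -EFinM lee_fin /e' mulrCA ler_piMr ?(ltW e20)//.
by rewrite ler_pdivrMr ?ltr_wpDl// mul1r lerDl.
Unshelve. all: by end_near. Qed.

(** Split the integral at [F]: on [F] the factor [q] is small and [w] has total integral [I]; off
    [F] the factor is at most 4 and [w] has small integral. Neither [F] nor [d] depends on [q]. *)
Lemma pure_point_small (e : R) : (0 < e)%R ->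
  exists F : {fset T}, exists2 d : R, (0 < d)%R & forall q : borel x0 -> R,
    (forall x, 0 <= q x <= 4)%R ->
    mu.-integrable setT (EFin \o (fun x => q x * w x)%R) ->
    (forall x, x \in F -> q x <= d)%R ->
    (\int[mu]_x (q x * w x) <= e)%R.
Proof.
(* The bound 4 on [q] turns the tail [e / 8] into [e / 2]. *)
move=> e0; have e80 : (0 < e / 8)%R by rewrite divr_gt0.
have [F FP] := pure_point_concentrated e80; exists F.
set I := fine (\int[mu]_x (w x)%:E).
have I0 : (0 <= I)%R by apply: fine_ge0; apply: integral_ge0 => x _;
  rewrite lee_fin.
have fI : \int[mu]_x (w x)%:E \is a fin_num by exact: integrable_fin_num w_int.
exists (e / 2 / (I + 1))%R; first by rewrite !divr_gt0// ltr_wpDl.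
move=> q q04 qi qF; rewrite -lee_fin /Rintegral fineK; last first.
  exact: integrable_fin_num qi.
have mF : measurable ([set` F] : set (borel x0)).
  by apply: measurable_finite; exact: finite_fset.
have mw D : measurable_fun D (fun x => (w x)%:E).
  exact: measurable_funTS (measurableT_comp (@EFin_measurable _ _) w_meas).
have mqw : measurable_fun setT (fun x => (q x * w x)%:E).
  by case/integrableP: qi.
have q0 x : (0 <= q x)%R by case/andP: (q04 x).
have qw0 x : 0 <= (q x * w x)%:E by rewrite lee_fin mulr_ge0.
rewrite -(setUv ([set` F] : set (borel x0))) ge0_integral_setU//=; last 3 first.
- exact: measurableC.
- by rewrite setUv.
- by apply/disj_setPS => x [/= Fx nFx]; exact: nFx.
rewrite [e]splitr EFinD; apply: leeD.
  apply: (@le_trans _ _ (\int[mu]_x ((e / 2 / (I + 1))%:E * (w x)%:E))).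
    rewrite integral_mkcond; apply: ge0_le_integral => //.
    - by move=> x _; rewrite patchE; case: ifP.
    - by apply/(measurable_restrictT _ mF); exact: measurable_funTS.
    - by apply: emeasurable_funM; [exact: measurable_cst|exact: mw].
    - move=> x _; rewrite patchE; case: ifPn => [|_].
        by rewrite inE => Fx; rewrite -EFinM lee_fin ler_wpM2r// qF.
      by rewrite -EFinM lee_fin !mulr_ge0// ?invr_ge0 ?addr_ge0// ltW.
  rewrite ge0_integralZl_EFin//; last 2 first.
  - by move=> x _; rewrite lee_fin.
  - by rewrite !mulr_ge0// ?invr_ge0 ?addr_ge0// ltW.
  rewrite -(fineK fI) -/I -EFinM lee_fin mulrAC -mulrA ler_piMr//.
    by rewrite ltW// divr_gt0.
  by rewrite ler_pdivrMr ?ltr_wpDl// mul1r lerDl.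
apply: (@le_trans _ _ (\int[mu]_(x in ~` [set` F]) (4%:E * (w x)%:E))).
  apply: ge0_le_integral => //.
  - exact: measurableC.
  - exact: measurable_funTS.
  - by apply: emeasurable_funM; [exact: measurable_cst|exact: mw].
  - by move=> x _; rewrite -EFinM lee_fin ler_wpM2r//; case/andP: (q04 x).
rewrite ge0_integralZl_EFin//; last 2 first.
- exact: measurableC.
- by move=> x _; rewrite lee_fin.
apply: (@le_trans _ _ (4%:E * (e / 8)%:E)).
  by rewrite lee_wpmul2l// lee_fin.
by rewrite -EFinM lee_fin; lra.
Qed.

End PurePoint.

(** * Characters and approximate periods *)

Section ReturnTimes.
Variables (R : realType) (G : lcaGroupType).
Implicit Types (chi : dual_group R G) (g h t : G) (L : set G).

Definition chR chi g : R := complex.Re (char_val chi g).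
Definition chI chi g : R := complex.Im (char_val chi g).
(* The square of |1 - chi t|. *)
Definition chdist chi t : R := (1 - chR chi t) ^+ 2 + chI chi t ^+ 2.

Lemma char_valP chi : characters (char_val chi : {compact-open, G -> R[i]^o}).
Proof. exact: set_mem (valP chi). Qed.

Lemma char_sqr1 chi g : chR chi g ^+ 2 + chI chi g ^+ 2 = 1.
Proof.
have [_ norm1 _] := char_valP chi.
have := add_Re2_Im2 (char_val chi g); rewrite norm1 expr1n.
by move=> /(congr1 (@complex.Re R)).
Qed.

Lemma chR_le1 chi g : `|chR chi g| <= 1.
Proof.
rewrite -(@ler_pXn2r _ 2)// ?nnegrE// real_normK ?num_real// expr1n.
by rewrite -(char_sqr1 chi g) lerDl sqr_ge0.
Qed.

Lemma chI_le1 chi g : `|chI chi g| <= 1.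
Proof.
rewrite -(@ler_pXn2r _ 2)// ?nnegrE// real_normK ?num_real// expr1n.
by rewrite -(char_sqr1 chi g) lerDr sqr_ge0.
Qed.

Lemma char_add chi g h :
  chR chi (g + h) = chR chi g * chR chi h - chI chi g * chI chi h /\
  chI chi (g + h) = chR chi g * chI chi h + chI chi g * chR chi h.
Proof.
have [_ _ mul] := char_valP chi; rewrite /chR /chI mul.
by case: (char_val chi g) => a b; case: (char_val chi h) => c d.
Qed.

(** Since [chi h] has modulus 1, multiplying by it turns [1 - chi (g - h)] into [chi h - chi g]
    without changing the modulus. *)
Lemma chdist_sub chi g h : chdist chi (g - h) =
  (chR chi g - chR chi h) ^+ 2 + (chI chi g - chI chi h) ^+ 2.
Proof.
have [e1 e2] := char_add chi (g - h) h; rewrite subrK in e1 e2.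
rewrite e1 e2 /chdist; have := char_sqr1 chi h.
set a := chR _ (g - h); set b := chI _ (g - h); set c := chR _ h.
set s := chI _ h => cs1; rewrite -[LHS]mulr1 -[X in _ * X]cs1; ring.
Qed.

Lemma char0 chi : chR chi 0 = 1 /\ chI chi 0 = 0.
Proof.
have [e1 e2] := char_add chi 0 0; rewrite addr0 in e1 e2.
have := char_sqr1 chi 0; move: e1 e2.
set c := chR _ _; set s := chI _ _ => e1 e2 e3.
have s0 : s = 0.
  have : s * (2 * c - 1) = 0 by rewrite {2}e2 in e3 *; nra.
  move=> /eqP; rewrite mulf_eq0 => /orP[/eqP//|/eqP c12].
  have {}c12 : c = 1 / 2 by lra.
  by move: e1 e3; rewrite c12; nra.
by split=> //; move: e1 e3; rewrite s0; nra.
Qed.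

Lemma chdistN chi t : chdist chi (- t) = chdist chi t.
Proof.
have [c0 s0] := char0 chi; rewrite -[- t]add0r chdist_sub c0 s0 /chdist; ring.
Qed.

Lemma chdist_itv chi t : 0 <= chdist chi t <= 4.
Proof.
rewrite addr_ge0 ?sqr_ge0//=; have := char_sqr1 chi t.
have := chR_le1 chi t; rewrite ler_norml /chdist => /andP[? ?]; nra.
Qed.

(* The cells are those of a partition of the torus formed by the values of the
   characters. *)
Lemma char_cells (s : seq (dual_group R G)) (d : R) : 0 < d ->
  exists (T : finType) (cell : G -> T), forall g h, cell g = cell h ->
    forall chi, chi \in s -> chdist chi (g - h) <= d.
Proof.
move=> d0; elim: s => [|chi s [T [cell cellP]]].
  by exists unit, (fun=> tt).
(* Real and imaginary parts in the same slot of width [1 / N] differ by at most [1 / N], so each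
   square is at most [1 / N], and [N > 2 / d] makes their sum at most [d]. *)
pose N := (Num.truncn (2 / d)).+1.
have N0 : 0 < N%:R :> R by rewrite ltr0n.
have N1 : 1 <= N%:R :> R by rewrite ler1n.
have dN : 2 / d < N%:R by rewrite /N truncnS_gt.
pose p (f : G -> R) g : 'I_(2 * N).+1 := inord (Num.truncn (N%:R * (f g + 1))).
have pP (f : G -> R) : (forall g, `|f g| <= 1) -> forall g h, p f g = p f h ->
    (f g - f h) ^+ 2 <= N%:R^-1.
  move=> f1 g h; have fb x : 0 <= f x + 1 <= 2.
    by have := f1 x; rewrite ler_norml => /andP[? ?]; apply/andP; split; lra.
  have fN x : 0 <= N%:R * (f x + 1).
    by have /andP[? _] := fb x; rewrite mulr_ge0.
  have bnd x : (Num.truncn (N%:R * (f x + 1)) < (2 * N).+1)%N.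
    rewrite ltnS -(ler_nat R); have /andP[+ _] := truncn_itv (fN x);
      move=> /le_trans; apply.
    by have /andP[_ ?] := fb x; rewrite natrM mulrC ler_pM2r.
  move=> /(congr1 val); rewrite /= !inordK// => e.
  have /andP[g1 g2] := truncn_itv (fN g);
    have /andP[h1 h2] := truncn_itv (fN h).
  rewrite e in g1 g2; rewrite -natr1 in g2 h2.
  have le1 : `|N%:R * (f g - f h)| <= 1.
    rewrite ler_norml; apply/andP; split; lra.
  have : (N%:R * (f g - f h)) ^+ 2 <= 1.
    by rewrite -[_ ^+ 2]real_normK ?num_real// expr_le1.
  rewrite exprMn -ler_pdivlMl ?exprn_gt0// mulr1 => /le_trans; apply.
  by rewrite lef_pV2 ?posrE ?exprn_gt0// expr2 ler_peMr// ltW.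
exists (T * ('I_(2 * N).+1 * 'I_(2 * N).+1))%type,
  (fun g => (cell g, (p (chR chi) g, p (chI chi) g))).
move=> g h [ecell eR eI] chi'; rewrite in_cons => /orP[/eqP->|];
  last exact: cellP.
rewrite chdist_sub; have := pP _ (chR_le1 chi) _ _ eR.
have := pP _ (chI_le1 chi) _ _ eI => h1 h2.
have Nd : N%:R^-1 <= d / 2.
  by rewrite -(invf_div 2 d) lef_pV2 ?posrE ?divr_gt0// ltW.
lra.
Qed.

Hypothesis noncompact : ~ compact [set: G].

(** Pick one point [rep tau] in each nonempty cell. The difference between [g] and the
    representative of its cell is an approximate period; if all of these lay in [L], the group would
    be [L] plus a finite set, hence compact. *)
Lemma return_time (s : seq (dual_group R G)) (d : R) L : 0 < d -> compact L ->
  exists2 t, ~ L t & forall chi, chi \in s -> chdist chi t <= d.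
Proof.
move=> d0 cL; have [T [cell cellP]] := char_cells s d0.
apply: contrapT => noret; apply: noncompact.
have repP (tau : T) : exists g, (exists h, cell h = tau) -> cell g = tau.
  have [[h <-]|no] := pselect (exists h, cell h = tau); first by exists h.
  by exists 0.
pose rep tau := projT1 (cid (repP tau)).
have repE g : cell (rep (cell g)) = cell g.
  by apply: (projT2 (cid (repP (cell g)))); exists g.
have <- : sumset L (rep @` [set: T]) = setT.
  apply/seteqP; split=> // g _; exists (g - rep (cell g)); last first.
    by exists (rep (cell g)); rewrite ?subrK.
  apply: contrapT => nL; apply: noret; exists (g - rep (cell g)) => //.
  by apply: cellP; rewrite repE.
apply: compact_sumset => //; apply: finite_compact.
exact: finite_image.
Qed.

(** Each new period avoids the compact set [L'], which keeps it different from the earlier ones and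
    [L]-far from them in both orders. *)
Lemma return_times (s : seq (dual_group R G)) (d : R) L (k : nat) :
  0 < d -> compact L -> exists r : seq G, [/\ size r = k, uniq r,
    far_apart L r & forall t chi, t \in r -> chi \in s -> chdist chi t <= d].
Proof.
move=> d0 cL; elim: k => [|k [r [sr ur fr rP]]]; first by exists [::].
pose L' := sumset ((L `|` -%R @` L) `|` [set 0]) [set` r].
have cL' : compact L'.
  apply: compact_sumset; last by apply: finite_compact; exact: finite_seq.
  apply: compactU; last exact: compact_set1.
  by apply: compactU => //; exact: compact_opp.
have [t nLt tP] := return_time s d0 cL'.
exists (t :: r); rewrite /= sr ur andbT; split=> //.
- apply/negP => tr; apply: nLt; exists 0; first by right.
  by exists t; rewrite ?add0r.
- move=> x y; rewrite !in_cons => /orP[/eqP->|xr] /orP[/eqP->|yr] // Lxy.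
  + by exfalso; apply: nLt; exists (t - y); [left; left|exists y;
    rewrite ?subrK].
  + exfalso; apply: nLt; exists (t - x); last by exists x; rewrite ?subrK.
    by left; right; exists (x - t); rewrite ?opprB.
  + exact: fr.
- by move=> t' chi; rewrite in_cons => /orP[/eqP->|]; [exact: tP|exact: rP].
Qed.

End ReturnTimes.

(** * Complex limits through real and imaginary parts *)

Section ComplexTopology.
Variable R : realType.
Local Open Scope complex_scope.

Lemma complex_norm_ltP (z : R[i]) (e : R) :
  (`|z| < e%:C) = (complex.Re z ^+ 2 + complex.Im z ^+ 2 < e ^+ 2) && (0 < e).
Proof.
rewrite normc_def ltcR; have [e0|e0] := ltP 0 e.
  by rewrite andbT -{1}[e]ger0_norm ?ltW// -sqrtr_sqr ltr_sqrt// exprn_gt0.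
by rewrite andbF; apply/negbTE; rewrite -leNgt (le_trans e0)// sqrtr_ge0.
Qed.

Lemma gt0_complexP (z : R[i]) : 0 < z -> exists2 e : R, 0 < e & z = e%:C.
Proof.
by case: z => a b; rewrite ltcE /= => /andP[/eqP-> a0]; exists a.
Qed.

Lemma cvg_complex (T : Type) (F : set_system T) {FF : Filter F}
    (f : T -> R[i]) (l : R[i]) :
  (f x : R[i]^o) @[x --> F] --> (l : R[i]^o) ->
  forall e : R, 0 < e -> \forall x \near F,
    `|complex.Re l - complex.Re (f x)| < e /\
    `|complex.Im l - complex.Im (f x)| < e.
Proof.
move=> /cvgrPdist_lt fl e e0; have e0C : 0 < e%:C by rewrite ltcR.
have := fl _ e0C; apply: filterS => x; rewrite complex_norm_ltP e0 andbT.
case: l {fl} => a b; case: (f x) => c d /= h.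
have sq (u v : R) : u ^+ 2 + v ^+ 2 < e ^+ 2 -> `|u| < e.
  move=> huv; rewrite -(@ltr_pXn2r _ 2)// ?nnegrE ?(ltW e0)//.
  rewrite real_normK ?num_real//; apply: le_lt_trans huv.
  by rewrite lerDl sqr_ge0.
by split; [exact: sq h|apply: sq; rewrite addrC; exact: h].
Qed.

Lemma real_complex_continuous (T : topologicalType) (f : T -> R) :
  continuous f -> continuous ((fun x => (f x)%:C) : T -> R[i]^o).
Proof.
move=> cf x; apply/cvgrPdist_lt => _ /gt0_complexP[e e0 ->].
have /cvgrPdist_lt/(_ e e0) := cf x; apply: filterS => y.
rewrite complex_norm_ltP e0 andbT /= subrr expr0n addr0.
move=> fe; rewrite -real_normK ?num_real// ltr_pXn2r// ?nnegrE//.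
exact: ltW.
Qed.

Lemma Re_continuous (T : topologicalType) (f : T -> R[i]) :
  continuous (f : T -> R[i]^o) -> continuous (fun x => complex.Re (f x)).
Proof.
move=> cf x; apply/cvgrPdist_lt => e e0.
by have := cvg_complex (cf x) e0 => /(_ _); apply: filterS => y [].
Qed.

Lemma Im_continuous (T : topologicalType) (f : T -> R[i]) :
  continuous (f : T -> R[i]^o) -> continuous (fun x => complex.Im (f x)).
Proof.
move=> cf x; apply/cvgrPdist_lt => e e0.
by have := cvg_complex (cf x) e0 => /(_ _); apply: filterS => y [].
Qed.

End ComplexTopology.

(** * Continuity of characters and measurability of points of the dual group *)

Section DualGroup.
Variables (R : realType) (G : lcaGroupType).
Implicit Type chi : dual_group R G.

Lemma chR_continuous chi : continuous (chR chi).
Proof. by have [c _ _] := char_valP chi; exact: Re_continuous. Qed.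

Lemma chI_continuous chi : continuous (chI chi).
Proof. by have [c _ _] := char_valP chi; exact: Im_continuous. Qed.

(** A point of the dual is the intersection over [g] of the conditions that fix the value at [g];
    the complement of each is a subbasic open set of the compact-open topology. *)
Lemma dual_point_measurable chi :
  measurable ([set chi] : set (borel (dual1 R G))).
Proof.
apply: borel_closed.
have -> : [set chi] = \bigcap_(g in [set: G])
    [set xi : dual_group R G | char_val xi g = char_val chi g].
  apply/seteqP; split=> [xi -> //|xi h]; apply: val_inj; apply/funext => g.
  exact: h.
apply: closed_bigI => g _.
have -> : [set xi : dual_group R G | char_val xi g = char_val chi g] =
    ~` [set xi : dual_group R G | char_val xi @` [set g] `<=` ~` [set char_val
      chi g]].
  apply/seteqP; split=> [xi /= e h|xi /= h].
    by apply: (h (char_val xi g)); [exists g|].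
  by apply: contrapT => ne; apply: h => _ [_ -> <-].
apply: open_closedC.
have oO : open (~` [set char_val chi g] : set R[i]^o).
  apply: closed_openC; apply: accessible_closed_set1.
  exact: hausdorff_accessible (@norm_hausdorff _ _).
have := compact_open_open (@compact_set1 G g) oO.
move=> oE; exists [set f | f @` [set g] `<=` ~` [set char_val chi g]] => //.
Qed.

End DualGroup.

(** * Pure point diffraction bounds the density of bad points *)

Section FewBadPoints.
Variables (R : realType) (G : lcaGroupType).
Variable theta : {measure set (borel (0 : G)) -> \bar R}.
Hypothesis haar : is_haar theta.
Implicit Types (S W : set G) (f : G -> R) (g t x y : G) (chi : dual_group R G).
Local Open Scope complex_scope.

Lemma cintegral_real (T : topologicalType) (x0 : T)
    (mu : {measure set (borel x0) -> \bar R}) (f : T -> R) :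
  cintegral mu (fun z => (f z)%:C) = (\int[mu]_z f z)%:C.
Proof. by rewrite /cintegral /= Rintegral_cst// mul0r. Qed.

Definition fourierR f chi : R := \int[theta]_x (chR chi x * f x).
Definition fourierI f chi : R := \int[theta]_x (chI chi x * f x).
Definition fourier_sqr f chi : R := fourierR f chi ^+ 2 + fourierI f chi ^+ 2.

Lemma inv_fourier_real f chi :
  inv_fourier theta (fun x => (f x)%:C) chi = fourierR f chi +i* fourierI f chi.
Proof.
rewrite /inv_fourier /cintegral; congr (_ +i* _); apply: eq_Rintegral => x _.
  by rewrite /chR; case: (char_val chi x) => a b; rewrite /= mulr0 subr0.
by rewrite /chI; case: (char_val chi x) => a b; rewrite /= mulr0 add0r.
Qed.

Lemma inv_fourier_sqr f chi :
  `|inv_fourier theta (fun x => (f x)%:C) chi| ^+ 2 = (fourier_sqr f chi)%:C.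
Proof. by rewrite inv_fourier_real -add_Re2_Im2. Qed.

Lemma csuppMl S (a f : G -> R) : continuous a -> csupp S f ->
  csupp S (fun x => a x * f x).
Proof.
move=> ca [cf cS f0]; split=> // [x|x /f0->]; last by rewrite mulr0.
by apply: continuousM; [exact: ca|exact: cf].
Qed.

(** A shift by [t] multiplies the transform of [f] by [chi t], so the difference multiplies it by
    [1 - chi t]. *)
Lemma fourier_diff S f t chi : csupp S f ->
  fourier_sqr (fun x => f x - f (x - t)) chi =
  chdist chi t * fourier_sqr f chi.
Proof.
move=> sf; have st := csupp_shift t sf.
have iR := csupp_integrable haar (csuppMl (@chR_continuous _ _ chi) sf).
have iI := csupp_integrable haar (csuppMl (@chI_continuous _ _ chi) sf).
have tR := csupp_integrable haar (csuppMl (@chR_continuous _ _ chi) st).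
have tI := csupp_integrable haar (csuppMl (@chI_continuous _ _ chi) st).
have iZ (c : R) (a : G -> R) :
    theta.-integrable setT (EFin \o (a : borel (0 : G) -> R)) ->
    theta.-integrable setT (EFin \o ((fun x => c * a x) : borel (0 : G) -> R)).
  move=> ia; have := integrableZl measurableT c ia; exact: eq_integrable.
have eR : \int[theta]_x (chR chi x * f (x - t)) =
    chR chi t * fourierR f chi - chI chi t * fourierI f chi.
  rewrite -[LHS](Rintegral_shift haar t tR) /fourierR /fourierI.
  rewrite -!RintegralZl// -RintegralB//; last 2 first.
  - exact: iZ.
  - exact: iZ.
  apply: eq_Rintegral => x _; rewrite (char_add chi x t).1 addrK; ring.
have eI : \int[theta]_x (chI chi x * f (x - t)) =
    chR chi t * fourierI f chi + chI chi t * fourierR f chi.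
  rewrite -[LHS](Rintegral_shift haar t tI) /fourierR /fourierI.
  rewrite -!RintegralZl// -RintegralD//; last 2 first.
  - exact: iZ.
  - exact: iZ.
  apply: eq_Rintegral => x _; rewrite (char_add chi x t).2 addrK; ring.
have dR : fourierR (fun x => f x - f (x - t)) chi =
    fourierR f chi - (chR chi t * fourierR f chi - chI chi t * fourierI f chi).
  rewrite -eR /fourierR -RintegralB//.
  by apply: eq_Rintegral => x _; rewrite mulrBr.
have dI : fourierI (fun x => f x - f (x - t)) chi =
    fourierI f chi - (chR chi t * fourierI f chi + chI chi t * fourierR f chi).
  rewrite -eI /fourierI -RintegralB//.
  by apply: eq_Rintegral => x _; rewrite mulrBr.
rewrite /fourier_sqr dR dI /chdist; ring.
Qed.

(** Real and imaginary part are each bounded by the integral of the absolute value of [f]. *)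
Lemma fourier_bounded S f : csupp S f ->
  exists M, forall chi, fourier_sqr f chi <= M.
Proof.
move=> sf; pose I := \int[theta]_x `|f x|; exists (I ^+ 2 + I ^+ 2) => chi.
have I0 : 0 <= I by exact: Rintegral_ge0.
have bnd (a : G -> R) : continuous a -> (forall x, `|a x| <= 1) ->
    (\int[theta]_x (a x * f x)) ^+ 2 <= I ^+ 2.
  move=> ca a1; rewrite -[leLHS]real_normK ?num_real// ler_pXn2r ?nnegrE//.
  have iaf := csupp_integrable haar (csuppMl ca sf).
  apply: (le_trans (le_normr_Rintegral measurableT iaf));
    apply: le_Rintegral => //.
  - by have := integrable_norm iaf; exact: eq_integrable.
  - by have := integrable_norm (csupp_integrable haar sf); exact: eq_integrable.
  - by move=> x _; rewrite normrM ler_piMl.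
apply: lerD; first exact: bnd (@chR_continuous _ _ chi) (@chR_le1 _ _ chi).
exact: bnd (@chI_continuous _ _ chi) (@chI_le1 _ _ chi).
Qed.

Lemma Cc_real S f : csupp S f -> Cc (fun x => (f x)%:C).
Proof.
move=> [cf cS f0]; split; first exact: real_complex_continuous.
apply: (subclosed_compact _ cS); first exact: closed_closure.
rewrite [X in _ `<=` X](closure_id _).1; last exact: lca_compact_closed.
apply: closureS => x /= fx; apply: contrapT => /f0 fx0.
by move: fx; rewrite fx0 eqxx.
Qed.

Lemma convolution_tilde f y :
  convolution theta (fun x => (f x)%:C) (tilde (fun x => (f x)%:C)) y =
  (corr theta f f y)%:C.
Proof.
rewrite /convolution -cintegral_real; congr (cintegral theta).
apply/funext => x; rewrite /tilde opprB conj_Creal ?complex_real//.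
by rewrite -rmorphM.
Qed.

Lemma corr_csupp S S' (a b : G -> R) : csupp S a -> csupp S' b ->
  csupp (sumset S (-%R @` S')) (corr theta a b).
Proof.
move=> sa sb; split; first exact: corr_continuous sa sb.
  by case: sa sb => _ cS _ [_ cS' _]; apply: compact_sumset => //;
    exact: compact_opp.
move=> y nS; rewrite /corr; have [_ _ a0] := sa; have [_ _ b0] := sb.
transitivity (\int[theta]_x ((fun=> 0) : borel (0 : G) -> R) x).
  apply: eq_Rintegral => x _; have [Sx|/a0->] := pselect (S x);
    last by rewrite mul0r.
  rewrite b0 ?mulr0// => S'x; apply: nS; exists x => //.
  exists (y - x); last by rewrite addrC subrK.
  by exists (x - y); rewrite ?opprB.
by rewrite Rintegral_cst// mul0r.
Qed.

Lemma bump U : nbhs (0 : G) U -> exists f S, [/\ csupp S f, f 0 != 0 &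
  forall x, ~ U x -> f x = 0].
Proof.
move=> nU; have [W [gW WU _]] := sym_nbhd_half nU.
have [oW W0 _ [K cK WK]] := gW.
have /uniform_separatorP - /(_ R)[f [cf _ f0 f1]] :
    uniform_separator (~` W) [set 0].
  (* Complete regularity separates a point from a closed set in this order; replacing [f] by [1 - f]
     reverses it. *)
  suff : uniform_separator [set (0 : G)] (~` W).
    case/(@uniform_separatorP _ R) => f [cf f01 f0 f1].
    apply/(@uniform_separatorP _ R); exists (fun x => 1 - f x); split.
    - by move=> x; apply: continuousB; [exact: cvg_cst|exact: cf].
    - move=> _ [x _ <-]; have /f01 : range f (f x) by exists x.
      by rewrite /= !in_itv/= => /andP[? ?]; apply/andP; split; lra.
    - by move=> _ [x nW <-]; rewrite (f1 (f x)) ?subrr//; exists x.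
    - by move=> _ [x -> <-]; rewrite (f0 (f 0)) ?subr0//; exists 0.
  have creg : completely_regular_space G.
    exact: (@locally_compact_completely_regular _ R lca_locally_compact
      lca_hausdorff).
  apply: creg.
    exact: open_closedC.
  by move=> /=; apply.
have fW x : ~ W x -> f x = 0 by move=> nW; apply: f0; exists x.
exists f, K; split.
- by split=> // x nK; apply: fW => /WK.
- by rewrite (f1 (f 0)) ?oner_neq0//; exists 0.
- by move=> x nU'; apply: fW => /WU.
Qed.

(* Pairs (g, g') of points contribute to the last sum only if g is close to
   g' + t, hence at most once for each g' and not at all if g' is bad. *)
Lemma corr_sum_ge (phi : G -> R) (P V : set G) (X r : seq G) t :
  (forall y, phi (- y) = phi y) -> (forall y, phi y <= phi 0) -> 0 <= phi 0 ->
  (forall y, ~ P y -> phi y = 0) ->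
  (forall x y z, P (x - z) -> P (y - z) -> V (x - y)) -> P 0 ->
  uniq X -> far_apart V X -> uniq r -> {subset r <= X} ->
  (forall g x, g \in r -> x \in X -> ~ P (x - (g + t))) ->
  2 * phi 0 * (size r)%:R <= \sum_(g <- X) \sum_(g' <- X)
    (2 * phi (g - g') - phi (g - g' - t) - phi (g - g' + t)).
Proof.
move=> phiN phi_le phi0 phiP PV P0 uX fX ur rX bad.
(* As [phi] is even, the shifts by [t] and [- t] contribute the same amount [s2] after exchanging
   the roles of [g] and [g']. *)
pose s1 := \sum_(g' <- X) \sum_(g <- X) phi (g - g').
pose s2 := \sum_(g' <- X) \sum_(g <- X) phi (g - (g' + t)).
have -> : \sum_(g <- X) \sum_(g' <- X)
    (2 * phi (g - g') - phi (g - g' - t) - phi (g - g' + t)) = 2 * (s1 - s2).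
  transitivity (2 * s1 - s2 - s2); last by ring.
  rewrite /s1 [X in 2 * X]exchange_big /= mulr_sumr.
  rewrite {1}/s2 [X in _ - X - _]exchange_big /= /s2 -!sumrB.
  apply: eq_bigr => g _; rewrite mulr_sumr -!sumrB; apply: eq_bigr => g' _.
  rewrite -[in RHS](phiN (g' - _)); congr (_ - phi _ - phi _); zmod.
rewrite -mulrA ler_pM2l// /s1 /s2 -sumrB.
have diag g' : g' \in X -> \sum_(g <- X) phi (g - g') = phi 0.
  move=> g'X; rewrite (bigD1_seq g')//= subrr big_seq_cond big1 ?addr0//.
  move=> g /andP[gX gg']; apply: phiP => Pg; move/eqP: gg'; apply.
  by apply: fX => //; apply: (PV _ _ g') => //; rewrite subrr.
have near g' : g' \in X -> \sum_(g <- X) phi (g - (g' + t)) <= phi 0.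
  move=> g'X;
    have [[g gX Pg]|no] := pselect (exists2 g, g \in X & P (g - (g' + t))).
    rewrite (bigD1_seq g)//= big_seq_cond big1 ?addr0//.
    move=> h /andP[hX hg]; apply: phiP => Ph; move/eqP: hg; apply.
    by apply: fX => //; exact: PV Ph Pg.
  rewrite big_seq_cond big1// => h /andP[hX _]; apply: phiP => Ph.
  by apply: no; exists h.
have zero g' : g' \in r -> \sum_(g <- X) phi (g - (g' + t)) = 0.
  move=> g'r; rewrite big_seq_cond big1// => h /andP[hX _]; apply: phiP.
  exact: bad.
have -> : phi 0 * (size r)%:R = \sum_(g' <- X | g' \in r) phi 0.
  rewrite -big_filter big_const_seq count_predT iter_addr_0 mulr_natr.
  congr (_ *+ _); apply/perm_size/uniq_perm => //; first exact: filter_uniq.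
  by move=> x; rewrite mem_filter; have [/rX->|] := boolP (x \in r).
rewrite big_mkcond /= big_seq_cond [leRHS]big_seq_cond.
apply: ler_sum => g' /andP[g'X _]; rewrite diag//.
case: ifPn => [/zero->|_]; first by rewrite subr0.
by rewrite subr_ge0; exact: near.
Qed.

Variable omega : set G.
Hypothesis omega_ud : uniformly_discrete omega.

Lemma omega_far : exists V, nbhs 0 V /\
  forall g h, omega g -> omega h -> V (g - h) -> g = h.
Proof.
have [V [nV _ tV]] := omega_ud; exists V; split=> // g h og oh Vgh.
apply: tV => //; exists g; rewrite !shiftsetE /=; split=> //=.
by rewrite subrr; exact: nbhs_singleton.
Qed.

Lemma omega_finite (K : set G) : compact K -> finite_set (K `&` omega).
Proof.
move=> cK; have [V [nV farV]] := omega_far.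
have [n nP] := far_apart_size cK nV; apply: contrapT => inf.
have [X XK sX] := infinite_set_fset n.+1 inf.
suff : (#|` X| <= n)%N by rewrite leqNgt sX.
apply: nP; first exact: fset_uniq.
  by move=> x xX; apply/mem_set; have [] := XK x xX.
move=> x y xX yX; apply: farV.
  by have [] := XK x xX.
by have [] := XK y yX.
Qed.

Definition bad_point W t g := forall x, omega x -> ~ W (x - (g + t)).

(** The characters [s] and the tolerance [d] depend only on [W] and [e]; the period [t] and the van
    Hove sequence come afterwards and are arbitrary. *)
Lemma few_bad_points : pure_point_diffractive theta omega ->
  forall W (e : R), nbhs 0 W -> 0 < e ->
  exists (s : seq (dual_group R G)), exists2 d : R, 0 < d & forall t,
    (forall chi, chi \in s -> chdist chi t <= d) ->
    forall C, van_hove theta C -> \forall n \near \oo, forall r : seq G, uniq r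
      ->
      (forall g, g \in r -> [/\ omega g, C n g & bad_point W t g]) ->
      (size r)%:R <= e * fine (theta (C n)).
Proof.
move=> [gamma [gammahat [_ auto [_ ft] pp]]] W e nW e0.
have [V [nV farV]] := omega_far.
(* [phi] will vanish off [W1]. Containment in [W] makes bad points contribute nothing to the shifted
   sum, and halving [V] leaves at most one point of [omega] [W1]-close to a given point. *)
have [W1 [gW1 W1VW W1W1]] := sym_nbhd_half (filterI nV nW).
have [U [gU UW1 UU]] := sym_nbhd_half (sym_nbhd_nbhs gW1).
have [f [S [sf f0 fU]]] := bump (sym_nbhd_nbhs gU).
have phi0 := corr_gt0 haar sf f0.
set phi := corr theta f f in phi0.
have phiP y : ~ W1 y -> phi y = 0.
  move=> nW1; apply: (corr_eq0 theta fU) => x Ux Uxy; apply: nW1.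
  have -> : y = x - (x - y) by zmod.
  by apply: (UU _ 0); rewrite ?subr0// sub0r; case: gU => _ _ sU _; exact: sU.
have [M MP] := fourier_bounded sf.
have [wint _] := ft _ (Cc_real sf).
have {}wint : gammahat.-integrable setT (EFin \o fourier_sqr f).
  by apply: eq_integrable wint => // chi _; rewrite inv_fourier_sqr.
have e'0 : 0 < e * phi 0 by rewrite mulr_gt0.
have w0 chi : 0 <= fourier_sqr f chi by rewrite addr_ge0// sqr_ge0.
have [F [d d0 FP]] := pure_point_small pp (@dual_point_measurable _ _) wint w0
  MP e'0.
exists (enum_fset F), d => // t tF C vC.
pose D x := f x - f (x - t).
have sD : csupp _ D := csuppB sf (csupp_shift t sf).
have [qint /(congr1 (@complex.Re R)) eqD] := ft _ (Cc_real sD).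
have small : complex.Re (cintegral gamma (fun y => (corr theta D D y)%:C)) <= e
  * phi 0.
  have <- : convolution theta (fun x => (D x)%:C) (tilde (fun x => (D x)%:C)) =
      (fun y => (corr theta D D y)%:C).
    by apply/funext => y; exact: convolution_tilde.
  rewrite eqD /=.
  have -> : \int[gammahat]_x complex.Re (`|inv_fourier theta (fun x => (D
    x)%:C) x| ^+ 2) =
      \int[gammahat]_x (chdist x t * fourier_sqr f x).
    by apply: eq_Rintegral => chi _;
      rewrite inv_fourier_sqr /= (fourier_diff t chi sf).
  apply: FP => [chi| |chi chiF]; [exact: chdist_itv| |exact: tF].
  apply: eq_integrable qint => // chi _.
  by rewrite inv_fourier_sqr /= (fourier_diff t chi sf).
have [cC C0 _] := vC.
have lim := auto C vC _ (Cc_real (corr_csupp sD sD)).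
have := cvg_complex lim e'0 => /(_ _); apply: filterS => n [+ _] r ur rP.
set L := complex.Re (cintegral _ _) in small *.
have mC0 : 0 < fine (theta (C n)) by rewrite fine_gt0// C0 haar_compact_lty.
have fin := omega_finite (cC n).
rewrite fsbig_finite//=.
under eq_bigr do rewrite fsbig_finite//=.
set X := enum_fset _.
have -> : \sum_(g <- X) \sum_(g' <- X) (corr theta D D (g - g'))%:C =
    (\sum_(g <- X) \sum_(g' <- X) corr theta D D (g - g'))%:C.
  by rewrite rmorph_sum; apply: eq_bigr => g _; rewrite rmorph_sum.
rewrite -fmorphV -rmorphM /=.
under eq_bigr do under eq_bigr do rewrite (corr_diff haar t _ sf) -/phi.
have inX g : (g \in X) = (g \in C n `&` omega) by rewrite in_fset_set.
set Y := \sum_(g <- X) _ => near_L.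
have Xo g : g \in X -> C n g /\ omega g by rewrite inX inE.
have geY : 2 * phi 0 * (size r)%:R <= Y.
  apply: (@corr_sum_ge phi W1 V) => //.
  - by move=> y; rewrite /phi (corrC haar _ sf sf).
  - by move=> y; exact: corr_le sf.
  - exact: ltW.
  - by move=> x y z Pxz Pyz; have [] := W1W1 _ _ _ Pxz (sym_nbhdN gW1 Pyz).
  - by case: gW1.
  - exact: fset_uniq.
  - by move=> x y /Xo[_ ox] /Xo[_ oy]; exact: farV.
  - by move=> g gr; have [og Cg _] := rP g gr; rewrite inX inE; split.
  - move=> g x gr /Xo[_ ox]; have [_ _ bg] := rP g gr => Px.
    by apply: (bg x ox); have [] := W1VW _ Px.
(* One summand [e * phi 0] bounds the limit, the other the distance to it; the factor 2 cancels
   against the one in [geY]. *)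
have : Y / fine (theta (C n)) <= 2 * (e * phi 0).
  by move: near_L; rewrite ltr_norml => /andP[h1 h2]; lra.
rewrite ler_pdivrMr// => leY.
rewrite -(@ler_pM2l _ (2 * phi 0)); last by rewrite mulr_gt0.
apply: (le_trans geY); apply: (le_trans leY).
by rewrite le_eqVlt; apply/orP; left; apply/eqP; ring.
Qed.

End FewBadPoints.

(** * Compactness of the hull *)

Section Hull.
Variable G : lcaGroupType.
Implicit Types (K V W : set G) (omega : set G).

(** An ultrafilter [F] converges to the set [A] of points each of whose neighbourhoods is met by
    [F]-almost all sets. Compactness of [A] within [K] gives one inclusion. For the other, each
    point of [K] outside [A + V] has a neighbourhood that [F]-almost all sets miss, and finitely
    many of these suffice. *)
Lemma closed_subset_compact : compact [set: closed_subset G].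
Proof.
rewrite compact_ultra => F UF _; have FF : Filter F by exact: ultra_proper.
pose A := [set x : G | forall U, nbhs x U ->
  F [set xi : closed_subset G | xi `&` U !=set0]].
have cA : closed A.
  move=> p clp U; rewrite nbhsE => -[Q [oQ Qp] QU].
  have [a [Aa Qa]] := clp _ (open_nbhs_nbhs (conj oQ Qp)).
  have := Aa _ (open_nbhs_nbhs (conj oQ Qa)); apply: filterS => xi.
  by move=> [x [xix /QU Ux]]; exists x.
exists (ClosedSubset cA); split=> // B /nbhsP[E [[K V] /= [cK oV V0] KVE] EB].
have nV : nbhs 0 V by exact: open_nbhs_nbhs.
suff : F [set xi | rubber_eps K V (ClosedSubset cA, xi)].
  by apply: filterS => xi h; apply: EB; apply/xsectionP; exact: KVE.
have [W [gW WV WW]] := sym_nbhd_half nV.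
have part1 : F [set xi : closed_subset G | A `&` K `<=` sumset xi V].
  have cAK : compact (A `&` K).
    by apply: (subclosed_compact _ cK); [apply: closedI => //;
      exact: lca_compact_closed|move=> x []].
  have /compact_near_coveringP := cAK.
  move=> /(_ _ F (fun xi x => sumset (xi : closed_subset G) V x) FF); apply.
  move=> x [Ax _]; exists ([set y | W (y - x)], [set xi : closed_subset G |
      xi `&` [set y | W (y - x)] !=set0]) => /=.
    split; first exact: nbhs_sub (sym_nbhd_nbhs gW).
    by apply: Ax; exact: nbhs_sub (sym_nbhd_nbhs gW).
  move=> [y xi] /= [Wyx [z [xiz Wzx]]]; exists z => //; exists (y - z).
    exact: WW Wyx (sym_nbhdN gW Wzx).
  by rewrite addrC subrK.
have part2 : F [set xi : closed_subset G | xi `&` K `<=` sumset A V].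
  pose K' := K `&` ~` sumset A V.
  have oAV : open (sumset A V).
    have -> : sumset A V = \bigcup_(a in A) [set x | V (x - a)].
      apply/seteqP; split=> [_ [a Aa [v Vv <-]]|x [a Aa Vxa]].
        by exists a; rewrite //= addrC addKr.
      by exists a => //; exists (x - a) => //; rewrite addrC subrK.
    by apply: bigcup_open => a _; exact: open_addr.
  have cK' : compact K'.
    apply: (subclosed_compact _ cK); last by move=> x [].
    by apply: closedI; [exact: lca_compact_closed|exact: open_closedC].
  have /compact_near_coveringP := cK'.
  move=> /(_ _ F (fun xi x => ~ closed_subset_val xi x) FF) h.
  have {}h : F [set xi : closed_subset G | K' `<=` [set x | ~ closed_subset_val
    xi x]].
    apply: h => x [Kx nAV].
    have nAx : ~ A x.
      by move=> Ax; apply: nAV; exists x => //; exists 0; rewrite ?addr0.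
    have [U [nU FU]] : exists U, nbhs x U /\ ~ F [set xi : closed_subset G | xi
      `&` U !=set0].
      apply: contrapT => h; apply: nAx => U nU; apply: contrapT => nF.
      by apply: h; exists U.
    exists (U, ~` [set xi : closed_subset G | xi `&` U !=set0]) => /=.
      by split=> //;
        have [] := in_ultra_setVsetC [set xi : closed_subset G | xi `&` U
          !=set0] UF.
    by move=> [y xi] /= [Uy nxi] xiy; apply: nxi; exists y.
  apply: filterS h => xi h x [xix Kx]; apply: contrapT => nAV.
  exact: (h x).
exact: filterI part1 part2.
Qed.

Lemma hull_compact omega : compact (hull omega).
Proof.
apply: (subclosed_compact _ closed_subset_compact) => //.
exact: closed_closure.
Qed.

(** On a compact uniform space every neighbourhood of the diagonal is an entourage, so it contains
    the restriction of a basic rubber entourage. *)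
Lemma hull_entourage omega (eta : set (hull omega * hull omega)) :
  set_nbhs diagonal eta -> exists K V, [/\ compact K, nbhs 0 V &
    forall x y : hull omega, rubber_eps K V (val x, val y) -> eta (x, y)].
Proof.
(* A property near [F] holds for all sufficiently small relations at once. *)
move=> neta; pose F : set_system (set (closed_subset G * closed_subset G)) :=
  filter_from entourage (fun E => [set E' | E' `<=` E]).
have FF : Filter F.
  apply: filter_from_filter; first by exists setT; exact: filterT.
  move=> E E' eE eE'; exists (E `&` E'); first exact: filterI.
  by move=> D DE; split=> z /DE[].
have /compact_near_coveringP := @hull_compact omega.
move=> /(_ _ F (fun E a => forall x y : hull omega, val x = a ->
  E (a, val y) -> eta (x, y)) FF) h.
have {h} [E eE] : \forall E \near F, hull omega `<=`
    [set a | forall x y : hull omega, val x = a -> E (a, val y) -> eta (x, y)].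
  apply: h => a ha; pose a' : hull omega := exist _ a (mem_set ha).
  have : nbhs (a', a') eta by apply: neta; apply/diagonalP.
  move=> [[N1 N2] /= [n1 n2] N12].
  have nN : nbhs a' (N1 `&` N2) by exact: filterI.
  move: nN; rewrite nbhsE => -[_ [[Q oQ <-] Qa] QN].
  have : nbhs a Q by apply: open_nbhs_nbhs; split.
  move=> /nbhsP[E0 eE0 E0Q]; have [D eD DD] := entourage_split_ex eE0.
  exists (xsection D a, [set E' | E' `<=` D]) => /=.
    by split; [apply/nbhsP; exists D|exists D].
  move=> [b E'] /= [/xsectionP Dab E'D] x y xb /E'D Dby; apply: (N12 (x, y)).
  have Ox : Q (val x).
    have Dax : D (a, val x) by move: Dab; rewrite -xb.
    apply: E0Q; apply/xsectionP; apply: DD; exists (val x) => //.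
    exact: entourage_refl eD.
  have Oy : Q (val y) by apply: E0Q; apply/xsectionP; apply: DD; exists b.
  by have [? _] := QN x Ox; have [_ ?] := QN y Oy.
move=> /(_ E) /= /(_ (fun _ => id)) h.
have [[K V] /= [cK oV V0] KVE] := eE; exists K, V; split=> //.
  exact: open_nbhs_nbhs.
move=> x y KVxy; apply: (h (val x)) => //; first exact: set_mem (valP x).
exact: KVE.
Qed.

Lemma hull_approx omega (x : hull omega) K V : compact K -> nbhs 0 V ->
  exists h, val x `&` K `<=` sumset (shiftset omega h) V /\
    shiftset omega h `&` K `<=` sumset (val x) V.
Proof.
move=> cK; rewrite nbhsE => -[V' [oV' V'0] V'V].
have hx : hull omega (val x) := set_mem (valP x).
have nx : nbhs (val x) (xsection (rubber_eps K V') (val x)).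
  by apply/nbhsP; exists (rubber_eps K V') => //; exists (K, V').
have [xi [[h xih] /xsectionP[/= h1 h2]]] := hx _ nx.
by exists h; rewrite -xih; split=> p => [/h1|/h2]; exact: sumsetS.
Qed.

End Hull.

(** * Codes for translates of omega *)

Section Codes.
Variables (R : realType) (G : lcaGroupType).
Variable theta : {measure set (borel (0 : G)) -> \bar R}.
Hypothesis haar : is_haar theta.
Variable omega : set G.
Hypothesis omega_ud : uniformly_discrete omega.
Hypothesis omega_pp : pure_point_diffractive theta omega.
Variable A : nat -> set G.
Hypothesis vA : van_hove theta A.
Implicit Types (K L Q V W : set G) (g h t p q x y : G).

Local Notation m X := (fine (theta X)).

Lemma compact_nbhd : exists2 Q : set G, compact Q & nbhs 0 Q.
Proof.
have [W [gW _ _]] := sym_nbhd_half (@filterT _ (nbhs (0 : G)) _).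
have [_ _ _ [Q cQ WQ]] := gW; exists Q => //.
exact: filterS WQ (sym_nbhd_nbhs gW).
Qed.

(** If the bound failed for some shift at infinitely many [n], those shifts would form a van Hove
    sequence of windows that violates [few_bad_points]. *)
Lemma few_bad_points_uniform W (e : R) : nbhs 0 W -> 0 < e ->
  exists (s : seq (dual_group R G)), exists2 d : R, 0 < d & forall t,
    (forall chi, chi \in s -> chdist chi t <= d) ->
    forall Q, compact Q -> nbhs 0 Q -> \forall n \near \oo,
    forall h (r : seq G), uniq r ->
      (forall g, g \in r ->
        [/\ omega g, reflected Q (A n) h g & bad_point omega W t g]) ->
      (size r)%:R <= e * m (A n).
Proof.
move=> nW e0; have [Q0 cQ0 nQ0] := compact_nbhd.
have [C C0 CP] := reflected_haar_le haar vA cQ0 nQ0.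
have eC0 : 0 < e / C by rewrite divr_gt0.
have [s [d d0 sP]] := few_bad_points haar omega_ud omega_pp nW eC0.
exists s, d => // t ts Q cQ nQ.
pose P n h := forall r : seq G, uniq r ->
  (forall g, g \in r ->
    [/\ omega g, reflected Q (A n) h g & bad_point omega W t g]) ->
  (size r)%:R <= e * m (A n).
(* Choose for each [n] a shift that violates the bound if there is one; the bound for this shift
   then implies it for all. *)
have hP n : exists h, P n h -> forall h', P n h'.
  have [[h nP]|no] := pselect (exists h, ~ P n h); first by exists h => /nP.
  by exists 0 => _ h; apply: contrapT => nP; apply: no; exists h.
pose h n := projT1 (cid (hP n)).
have hE n : P n (h n) -> forall h', P n h' := projT2 (cid (hP n)).
have vC := reflected_van_hove haar h vA cQ nQ.
apply: filterS2 (sP t ts _ vC) (CP Q cQ) => n badn leC; apply: hE => r ur rP.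
apply: (le_trans (badn r ur rP)); have := leC (h n).
by rewrite -(ler_pM2l eC0) mulrA divfK// gt_eqF.
Qed.

Lemma near_seq (T : eqType) (r : seq T) (P : T -> nat -> Prop) :
  (forall u, u \in r -> \forall n \near \oo, P u n) ->
  \forall n \near \oo, forall u, u \in r -> P u n.
Proof.
elim: r => [|u r ih] h; first by apply: nearW.
apply: filterS2 (h u (mem_head _ _)) (ih _) => [n Pu Pr u'|u' u'r].
  by rewrite in_cons => /orP[/eqP->|/Pr].
by apply: h; rewrite in_cons u'r orbT.
Qed.

(** The state of the cell with centre [y] for the translate [omega + h], read with tolerance [W]. *)
Definition occupied W h y := exists2 p, omega (p - h) & W (p - y).

(** * Coding a window by a grid of cells *)

Section Grid.
Variables (Va Wb W1 W2 W3 : set G).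
Hypotheses (gVa : sym_nbhd Va) (gW3 : sym_nbhd W3).
Hypothesis sWb : Wb `<=` Va.
Hypothesis sW1 : W1 `<=` Wb.
Hypothesis sW2 : W2 `<=` W1.
Hypothesis sW3 : W3 `<=` W2.
Hypothesis WbVa : forall x y z, Wb (x - y) -> Wb (y - z) -> Va (x - z).
Hypothesis W1Wb : forall x y z, W1 (x - y) -> W1 (y - z) -> Wb (x - z).
Hypothesis W2W1 : forall x y z, W2 (x - y) -> W2 (y - z) -> W1 (x - z).
Hypothesis W3W2 : forall x y z, W3 (x - y) -> W3 (y - z) -> W2 (x - z).
Variable Q : set G.
Hypothesis VaQ : Va `<=` Q.

(** A point of [omega + h] close to [p - t] would be [W1]-close to [z], as both [p - t] and [z] are
    close to [y - t]. So copying the state of [y] to [z] fails only at points that are bad for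
    [- t]. *)
Lemma forward_copy t p y z h : W3 (p - y) -> W3 (y - t - z) ->
  ~ occupied W1 h z -> bad_point omega W3 (- t) (p - h).
Proof.
move=> py ytz nz x ox Wx; apply: nz; exists (x + h); first by rewrite addrK.
apply: (W2W1 (y := y - t)); last exact: sW3.
apply: (W3W2 (y := p - t)).
  by have -> : x + h - (p - t) = x - (p - h - t) by zmod.
by have -> : p - t - (y - t) = p - y by zmod.
Qed.

(** The same argument from [z] back to [y]. Each copy loses precision, which is why three tolerances
    [W3], [W1] and [Va] are used for one cell. *)
Lemma backward_copy t q y z h : W1 (q - z) -> W3 (y - t - z) ->
  ~ occupied Va h y -> Wb (q + t - y) /\ bad_point omega W3 t (q - h).
Proof.
move=> qz ytz ny; have near_y : Wb (q + t - y).
  apply: (W1Wb (y := z + t));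
    first by have -> : q + t - (z + t) = q - z by zmod.
  apply: sW2; apply: sW3; have -> : z + t - y = z - (y - t) by zmod.
  exact: sym_nbhdN.
split=> // x ox Wx; apply: ny; exists (x + h); first by rewrite addrK.
apply: (WbVa (y := q + t)); last exact: near_y.
apply: sW1; apply: sW2; apply: sW3.
by have -> : x + h - (q + t) = x - (q - h + t) by zmod.
Qed.

Variables (s : seq G) (us : uniq s) (fs : far_apart W3 s).
Let N := size s.
Let X (j : 'I_N) : G := s`_j.

Let X_inj : injective X.
Proof. by move=> i j /eqP; rewrite /X nth_uniq// => /eqP/val_inj. Qed.

Let X_mem j : X j \in s. Proof. exact: mem_nth. Qed.

Let X_onto y : y \in s -> exists j, X j = y.
Proof.
move=> ys; have lt : (index y s < N)%N by rewrite index_mem.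
by exists (Ordinal lt); rewrite /X /= nth_index.
Qed.

Variable c0 : nat.
Hypothesis c0P : forall s' : seq G, uniq s' -> {subset s' <= Q} ->
  far_apart W3 s' -> (size s' <= c0)%N.

(** The differences [p - X j] are far apart inside the compact set [Q]. *)
Lemma grid_multiplicity (Y : {set 'I_N}%SET) p :
  (forall j, j \in Y -> Q (p - X j)) -> (#|Y| <= c0)%N.
Proof.
move=> YQ; rewrite cardE -(size_map (fun j => p - X j)); apply: c0P.
- by rewrite map_inj_uniq ?enum_uniq// => i j /addrI/oppr_inj/X_inj.
- by move=> _ /mapP[j jY ->]; apply/mem_set/YQ; rewrite mem_enum in jY.
- move=> _ _ /mapP[i _ ->] /mapP[j _ ->].
  have -> : p - X i - (p - X j) = X j - X i by zmod.
  by move=> /fs => /(_ (X_mem j) (X_mem i)) ->.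
Qed.

Variables (K1 A' : set G) (r : seq G) (Q2 : set G).
Hypothesis Q2P : forall k u v, K1 k -> Q v -> u = 0 \/ u \in r ->
  Q2 (k - u + v).
Let J0 : {set 'I_N}%SET := [set j | `[<reflected K1 A' 0 (X j)>]]%SET.

Variable nu : nat.

(** The cells blamed on a bad point [p]: with [u = 0] the cell is near [p] (forward failure), with
    [u = t] it is near [p + t] (backward failure). *)
Definition bad_cells h tau u : {set 'I_N}%SET := [set j in J0 |
  `[<exists p, [/\ omega (p - h), Wb (p + u - X j) &
       bad_point omega W3 tau (p - h)]>]]%SET.

(** Assign to each bad cell a bad point that causes it. A point serves at most [c0] cells, and all
    these points lie in a window that contains at most [nu] bad points. *)
Lemma card_bad_cells h tau u : u = 0 \/ u \in r ->
  (forall r' : seq G, uniq r' -> (forall g, g \in r' ->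
     [/\ omega g, reflected Q2 A' (- h) g & bad_point omega W3 tau g]) ->
     (size r' <= nu)%N) ->
  (#|bad_cells h tau u| <= c0 * nu)%N.
Proof.
move=> ur bnd; set B := bad_cells h tau u.
have fP j : exists p, j \in B -> [/\ omega (p - h), Wb (p + u - X j) &
    bad_point omega W3 tau (p - h)].
  have [|] := boolP (j \in B); last by exists 0.
  by rewrite inE => /andP[_ /asboolP[p pP]]; exists p.
pose f j := projT1 (cid (fP j)).
have fE j : j \in B -> _ := projT2 (cid (fP j)).
apply: (@leq_trans (c0 * size (undup (map f (enum B))))).
  apply: card_fibers => [y yB|p].
    by rewrite mem_undup; apply: map_f; rewrite mem_enum.
  apply: (@grid_multiplicity _ (p + u)) => j; rewrite inE => /andP[jB /eqP <-].
  by have [_ Wj _] := fE j jB; apply/VaQ/sWb.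
rewrite leq_mul2l; apply/orP; right; set ps := undup _.
rewrite -(size_map (fun p => p - h)); apply: bnd.
  by rewrite map_inj_uniq ?undup_uniq//; exact: addIr.
move=> _ /mapP[p + ->]; rewrite mem_undup => /mapP[j + ->].
rewrite mem_enum => jB; have [op Wp bp] := fE j jB; split=> //.
move: (jB); rewrite inE => /andP[+ _]; rewrite inE => /asboolP.
move=> /reflectedP[k [a [K1k Aa Xj]]]; apply/reflectedP.
exists (k - u + (f j + u - X j)), a; split=> //.
  by apply: Q2P => //; apply/VaQ/sWb.
rewrite Xj; zmod.
Qed.

Variables (K B' V : set G) (M e : nat).
Hypothesis VaV : forall x y z, Va (x - y) -> Va (y - z) -> V (x - z).
Hypothesis covB' : forall p, B' p -> exists2 y, y \in s & W3 (p - y).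
Hypothesis K_B' : forall p, reflected K A' 0 p -> B' p.
Hypothesis K_K1 : forall p y, reflected K A' 0 p -> W3 (p - y) ->
  reflected K1 A' 0 y.
Hypothesis K1_B' : forall y t, reflected K1 A' 0 y -> t \in r -> B' (y - t).
Hypotheses (ur : uniq r) (fr : far_apart Q r) (M0 : (0 < M)%N).
Hypothesis sr : size r = (M * M)%N.
Hypothesis few_bad : forall h t tau, t \in r -> tau = t \/ tau = - t ->
  forall r' : seq G, uniq r' ->
  (forall g, g \in r' ->
    [/\ omega g, reflected Q2 A' (- h) g & bad_point omega W3 tau g]) ->
  (size r' <= nu)%N.
Hypothesis leNe : forall u, (u * M <= N)%N ->
  (u + M * M * (c0 * nu + c0 * nu) <= e)%N.

(* The occupied cells are recorded on the sparse set S; every other cell copies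
   the state of a translated cell in S, except for the few exceptional ones,
   which are recorded separately. *)
Lemma grid_codes : exists code : G ->
    ({set 'I_N} * {set 'I_N} * {set 'I_N})%type,
  (forall h, [/\ #|(code h).1.1| <= e, #|(code h).1.2| <= e &
     #|(code h).2| <= e]%N) /\
  forall h h', code h = code h' -> forall p, omega (p - h) ->
    reflected K A' 0 p -> exists2 q, omega (q - h') & V (p - q).
Proof.
pose rho (z y : 'I_N) := `[<exists2 t, t \in r & W3 (X y - t - X z)>].
(* Two periods leading from [y] to the same cell would differ by an element of [Q], so the periods
   lead to distinct cells. *)
have deg (y : 'I_N) : y \in J0 -> (M * M <= #|[set z | rho z y]%SET|)%N.
  rewrite inE => /asboolP K1y.
  have zP t : exists z, t \in r -> W3 (X y - t - X z).
    have [tr|] := boolP (t \in r); last by exists y.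
    by have [_ /X_onto[z <-] Wz] := covB' (K1_B' K1y tr); exists z.
  pose z t := projT1 (cid (zP t)).
  have zE t : t \in r -> W3 (X y - t - X (z t)) := projT2 (cid (zP t)).
  rewrite -sr -(size_map z) cardE; apply: uniq_leq_size.
    rewrite map_inj_in_uniq// => t t' tr t'r ztt'; apply: fr => //.
    apply: VaQ; apply: sWb; apply: sW1; apply: sW2.
    have -> : t - t' = (X y - t') - (X y - t) by zmod.
    apply: (W3W2 (y := X (z t))); first by rewrite ztt'; exact: zE.
    by apply: sym_nbhdN => //; exact: zE.
  move=> _ /mapP[t tr ->]; rewrite mem_enum inE; apply/asboolP.
  by exists t => //; exact: zE.
(* With degree [M * M], both [S] and the uncovered part [U] contain at most [N / M] cells. *)
have [S [SM UM]] := greedy_cover M0 deg; rewrite card_ord in SM UM.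
set U := [set i in J0 | _]%SET in UM.
have {}UM : (#|U| * M <= N)%N.
  by move: UM; rewrite mulnA [X in (X <= _)%N]mulnC leq_pmul2l.
pose fine h (y : 'I_N) := forall (z : 'I_N) t, z \in S -> t \in r -> W3 (X y -
  t - X z) ->
  (occupied W3 h (X y) -> occupied W1 h (X z)) /\
  (occupied W1 h (X z) -> occupied Va h (X y)).
pose Exc h : {set 'I_N} := [set i in J0 | (i \in U) || ~~ `[<fine h i>]]%SET.
pose occ W h : {set 'I_N} := [set i | `[<occupied W h (X i)>]]%SET.
(* Cells of [S] are read with the tolerance [W1] that a forward copy guarantees, exceptional cells
   directly with [W3]. *)
pose code h := (S :&: occ W1 h, Exc h, Exc h :&: occ W3 h)%SET.
have leExc h : (#|Exc h| <= e)%N.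
  apply: leq_trans (leNe UM); rewrite -sr.
  (* An exceptional cell outside [U] fails to copy along some period [t]: forwards because of a
     point bad for [- t], or backwards because of one bad for [t]. *)
  apply: (@card_cover_seq _ _ (fun t => bad_cells h (- t) 0 :|: bad_cells h t
    t)%SET).
    move=> y; rewrite inE => /andP[yJ0 /orP[|/asboolP nf]]; first by left.
    right; apply: contrapT => no; apply: nf => z t zS tr yz; split=> occ1.
      apply: contrapT => nocc; apply: no; exists t => //.
      rewrite !inE; apply/orP; left; move: (yJ0); rewrite inE => ->.
      have [p op py] := occ1; apply/asboolP; exists p.
      split=> //; first by rewrite addr0; exact/sW1/sW2/sW3.
      exact: forward_copy py yz nocc.
    apply: contrapT => nocc; apply: no; exists t => //.
    rewrite !inE; apply/orP; right; move: (yJ0); rewrite inE => ->.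
    have [q oq qz] := occ1; apply/asboolP; exists q.
    by have [] := backward_copy qz yz nocc.
  move=> t tr; rewrite (leq_trans (leq_card_setU _ _).1)//.
  apply: leq_add; apply: card_bad_cells => [|r'].
  - by left.
  - by apply: few_bad tr _ r'; right.
  - by right.
  - by apply: few_bad tr _ r'; left.
have leS h : (#|S :&: occ W1 h| <= e)%SET%N.
  apply: (@leq_trans #|S|); first exact: subset_leq_card (subsetIl _ _).
  by apply: leq_trans (leNe SM); exact: leq_addr.
exists code; split=> [h|h h' [eS eE eO] p op Kp].
  split=> //=; apply: leq_trans (leExc h);
    exact: subset_leq_card (subsetIl _ _).
have [_ /X_onto[j <-] pj] := covB' (K_B' Kp).
have jJ0 : j \in J0 by rewrite inE; apply/asboolP; exact: K_K1 pj.
have occj : occupied W3 h (X j) by exists p.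
have V3a : W3 `<=` Va by move=> x /sW3/sW2/sW1/sWb.
have [jE|jE] := boolP (j \in Exc h).
  have : j \in (Exc h' :&: occ W3 h')%SET.
    by rewrite -eO inE jE /= inE; apply/asboolP.
  rewrite inE => /andP[_]; rewrite inE => /asboolP[q oq qj]; exists q => //.
  by apply: (VaV (y := X j)); apply: V3a => //; exact: sym_nbhdN.
have jE' : j \notin Exc h' by rewrite -eE.
move: jE jE'; rewrite inE jJ0 /= negb_or negbK => /andP[jU /asboolP fj].
rewrite inE jJ0 /= negb_or negbK => /andP[_ /asboolP fj'].
have [z [zS /asboolP[t tr jz]]] : exists z, z \in S /\ rho z j.
  move: jU; rewrite inE jJ0 negb_forall => /existsP[z];
    rewrite negb_imply negbK.
  by move=> /andP[zS rz]; exists z.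
(* The state of [j] is copied forward to [z] for [h], transferred to [h'] by the equality of codes,
   and copied back to [j] for [h']. *)
have [/(_ occj) occz _] := fj z t zS tr jz.
have : z \in (S :&: occ W1 h')%SET.
  by rewrite -eS inE zS /= inE; apply/asboolP.
rewrite inE => /andP[_]; rewrite inE => /asboolP occz'.
have [_ /(_ occz')[q oq qj]] := fj' z t zS tr jz; exists q => //.
by apply: (VaV (y := X j)); [exact: V3a|exact: sym_nbhdN].
Qed.

End Grid.

Hypothesis noncompact : ~ compact [set: G].

Lemma few_codes K V (delta : R) : compact K -> nbhs 0 V -> 0 < delta ->
  \forall n \near \oo, exists (T : finType) (D : {set T}%SET) (code : G -> T),
    [/\ forall h, code h \in D, #|D|%:R <= expR (delta * m (A n)) &
    forall h h', code h = code h' -> forall p, omega (p - h) ->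
      reflected K (A n) 0 p -> exists2 q, omega (q - h') & V (p - q)].
Proof.
move=> cK nV delta0.
have [Va [gVa _ VaV]] := sym_nbhd_half nV.
have [Wb [gWb sWb WbVa]] := sym_nbhd_half (sym_nbhd_nbhs gVa).
have [W1 [gW1 sW1 W1Wb]] := sym_nbhd_half (sym_nbhd_nbhs gWb).
have [W2 [gW2 sW2 W2W1]] := sym_nbhd_half (sym_nbhd_nbhs gW1).
have [W3 [gW3 sW3 W3W2]] := sym_nbhd_half (sym_nbhd_nbhs gW2).
have [_ _ _ [Q cQ VaQ]] := gVa.
have nQ : nbhs 0 Q by exact: filterS VaQ (sym_nbhd_nbhs gVa).
have [c c_gt0 cP] := far_apart_measure haar gW3.
have [C C0 CP] := reflected_haar_le haar vA cQ nQ.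
have [c0 c0P] := far_apart_size cQ (sym_nbhd_nbhs gW3).
pose C1 := C / c; have C10 : 0 < C1 by rewrite divr_gt0.
(* A code is a triple of small subsets, so each subset may cost [delta / 3]. This is split into
   three terms of at most [delta / 9]: [x * C1] from [(1 + x) ^+ N], [l * (C1 / M)] from the [N / M]
   uncovered cells, and [l * (B * ep)] from the bad cells. Since [B] contains the number [M * M] of
   periods, [ep] is chosen after [M]. *)
pose x := delta / (9 * C1 + delta).
have den0 : 0 < 9 * C1 + delta by rewrite addr_gt0// mulr_gt0.
have x0 : 0 < x by rewrite divr_gt0.
have x1 : x <= 1 by rewrite ler_pdivrMr// mul1r lerDr mulr_ge0// ltW.
have xC1 : x * C1 <= delta / 9.
  by rewrite /x mulrAC ler_pdivrMr//; nra.
pose l := - ln x.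
have l0 : 0 <= l by rewrite oppr_ge0 ln_le0.
have xE : x = expR (- l) by rewrite opprK lnK.
pose M := (Num.truncn (9 * l * C1 / delta)).+1.
have M0 : 0 < M%:R :> R by rewrite ltr0n.
have lM : l * (C1 / M%:R) <= delta / 9.
  have : 9 * l * C1 / delta < M%:R by exact: truncnS_gt.
  rewrite ltr_pdivrMr// => /ltW h; rewrite mulrA ler_pdivrMr//; nra.
pose B : R := (M * M * (c0 + c0))%:R; have B0 : 0 <= B by rewrite ler0n.
pose ep := delta / (9 * (l * B + 1)).
have lB1 : 0 < l * B + 1 by rewrite ltr_wpDl// mulr_ge0.
have ep0 : 0 < ep by rewrite divr_gt0// mulr_gt0.
have lBe : l * (B * ep) <= delta / 9.
  have aux (u v : R) : v != 0 ->
      l * (u * (delta / (9 * v))) = delta / 9 * (l * u / v) by move=> v0; field.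
  rewrite /ep aux ?gt_eqF//.
  by rewrite ler_piMr ?divr_ge0 ?(ltW delta0)// ler_pdivrMr// mul1r lerDl.
have [s [d d0 sP]] := few_bad_points_uniform (sym_nbhd_nbhs gW3) ep0.
have [r [sr ur fr rP]] := return_times noncompact s (M * M) d0 cQ.
pose rneg : set G := [set 0] `|` -%R @` [set` r].
have crneg : compact rneg.
  apply: compactU; first exact: compact_set1.
  by apply: compact_opp; apply: finite_compact; exact: finite_seq.
pose K1 := sumset K Q; have cK1 : compact K1 by exact: compact_sumset.
pose K' := sumset (K `|` K1) rneg.
have cK' : compact K' by apply: compact_sumset => //; exact: compactU.
(* The part [Q] makes [Q2] a neighbourhood of 0, as the uniform bound on bad points requires. *)
pose Q2 := sumset (sumset K1 rneg) Q `|` Q.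
have cQ2 : compact Q2.
  by apply: compactU => //; apply: compact_sumset => //; exact: compact_sumset.
have nQ2 : nbhs 0 Q2 by apply: filterS nQ => z Qz; right.
have near1 := CP _ (compact_sumset cK' cQ).
have near2 : \forall n \near \oo, forall t, t \in r -> forall tau,
    tau = t \/ tau = - t -> forall h (r' : seq G), uniq r' ->
    (forall g, g \in r' ->
       [/\ omega g, reflected Q2 (A n) h g & bad_point omega W3 tau g]) ->
    (size r')%:R <= ep * m (A n).
  apply: near_seq => t tr.
  have st : forall chi, chi \in s -> chdist chi t <= d by move=> chi; exact: rP.
  have st' : forall chi, chi \in s -> chdist chi (- t) <= d.
    by move=> chi; rewrite chdistN; exact: rP.
  apply: filterS2 (sP t st Q2 cQ2 nQ2) (sP _ st' Q2 cQ2 nQ2) => n.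
  by move=> h1 h2 tau [->|->].
apply: filterS2 near1 near2 => n leC few.
have [cA A0 _] := vA.
have m0 : 0 < m (A n) by rewrite fine_gt0// A0 haar_compact_lty.
pose B' := reflected K' (A n) 0.
have [sq [us sB fs cov]] := maximal_far_apart (compact_reflected (h := 0) cK'
  (cA n)) gW3.
set N := size sq.
have NC1 : N%:R <= C1 * m (A n).
  rewrite /C1 mulrAC ler_pdivlMr//; apply: le_trans (leC 0); apply: cP => //.
    by apply: compact_reflected => //; exact: compact_sumset.
  move=> y v /sB/set_mem/reflectedP[k [a [K'k Aa ->]]] Wv.
  apply/reflectedP; exists (k + v), a; split=> //; last by zmod.
  by exists k => //; exists v => //; apply/VaQ/sWb/sW1/sW2/sW3.
pose nu := Num.truncn (ep * m (A n)).
have epm0 : 0 <= ep * m (A n) by rewrite mulr_ge0// ltW.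
pose b := (C1 / M%:R + B * ep) * m (A n).
have b0 : 0 <= b.
  apply: mulr_ge0; last exact: ltW.
  by apply: addr_ge0; [rewrite divr_ge0// ltW|rewrite mulr_ge0// ltW].
pose e := Num.truncn b.
have leNe u : (u * M <= N)%N -> (u + M * M * (c0 * nu + c0 * nu) <= e)%N.
  rewrite -(ler_nat R) natrM => uM; rewrite truncn_ge_nat//.
  rewrite -mulnDl mulnA natrD [(_ * nu)%:R]natrM -/B /b mulrDl lerD//.
    rewrite mulrAC ler_pdivlMr//; exact: le_trans uM NC1.
  by rewrite -mulrA ler_wpM2l// -truncn_ge_nat.
have Q2P k u v : K1 k -> Q v -> u = 0 \/ u \in r -> Q2 (k - u + v).
  move=> K1k Qv ur0; left; exists (k - u); last by exists v.
  exists k => //; exists (- u) => //; case: ur0 => [->|ur0].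
    by left; rewrite oppr0.
  by right; exists u.
have K_B' p : reflected K (A n) 0 p -> B' p.
  move=> /reflectedP[k [a [Kk Aa ->]]]; apply/reflectedP; exists k, a;
    split=> //.
  by exists k; [left|exists 0; [left|rewrite addr0]].
have K_K1 p y : reflected K (A n) 0 p -> W3 (p - y) -> reflected K1 (A n) 0 y.
  move=> /reflectedP[k [a [Kk Aa ->]]] Wpy; apply/reflectedP.
  exists (y + a), a; split=> //; last by zmod.
  exists k => //; exists (y - (k - a + 0)); last by zmod.
  by apply/VaQ/sWb/sW1/sW2/sW3; exact: sym_nbhdN.
have K1_B' y t : reflected K1 (A n) 0 y -> t \in r -> B' (y - t).
  move=> /reflectedP[k [a [Kk Aa ->]]] tr; apply/reflectedP.
  exists (k - t), a; split=> //; last by zmod.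
  by exists k; [right|exists (- t) => //; right; exists t].
have few_nu h t tau : t \in r -> tau = t \/ tau = - t ->
    forall r' : seq G, uniq r' -> (forall g, g \in r' ->
      [/\ omega g, reflected Q2 (A n) (- h) g & bad_point omega W3 tau g]) ->
    (size r' <= nu)%N.
  move=> tr tauE r' ur' r'P; rewrite truncn_ge_nat//.
  exact: few t tr tau tauE (- h) r' ur' r'P.
have [code [codeP decode]] := grid_codes gVa gW3 sWb sW1 sW2 sW3 WbVa W1Wb W2W1
  W3W2 VaQ us fs c0P Q2P VaV cov K_B' K_K1 K1_B' ur fr (ltn0Sn _) sr few_nu
    leNe.
pose Sm := [set S : {set 'I_N} | (#|S| <= e)%N]%SET.
exists _, (finset.setX (finset.setX Sm Sm) Sm), code; split=> //.
  move=> h; move: (codeP h); case: (code h) => [[a1 a2] a3] /= [h1 h2 h3].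
  by rewrite !finset.in_setX /= !inE h1 h2 h3.
(* Dividing the bound of [card_small_subsets] by [x ^+ e = expR (- (l * e))] and using
   [1 + x <= expR x] gives the exponent. *)
have leSm : #|Sm|%:R <= expR (l * b + x * (C1 * m (A n))).
  have := @card_small_subsets R N e x; rewrite x1 ltW// => /(_ isT) hS.
  have xe : x ^+ e = expR (- (l * e%:R)).
    by rewrite xE -expRM_natl mulrN mulrC.
  rewrite xe in hS.
  have -> : #|Sm|%:R = #|Sm|%:R * expR (- (l * e%:R)) * expR (l * e%:R) :> R.
    by rewrite -mulrA -expRD addNr expR0 mulr1.
  apply: (@le_trans _ _ ((1 + x) ^+ N * expR (l * e%:R))).
    by rewrite ler_wpM2r// expR_ge0.
  apply: (@le_trans _ _ (expR x ^+ N * expR (l * e%:R))).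
    rewrite ler_wpM2r ?expR_ge0// lerXn2r ?nnegrE ?expR_ge0 ?addr_ge0 ?(ltW
      x0)//.
    exact: expR_ge1Dx.
  rewrite -expRM_natl -expRD ler_expR addrC lerD//.
    by rewrite ler_wpM2l// -truncn_ge_nat.
  by rewrite mulrC ler_wpM2l// ltW.
rewrite !cardsX !natrM.
apply: (@le_trans _ _ (expR (l * b + x * (C1 * m (A n))) ^+ 3)).
  rewrite !exprS expr0 mulr1 mulrA.
  by rewrite !ler_pM ?mulr_ge0.
rewrite -expRM_natl ler_expR /b.
move: (m (A n)) m0 => mA mA0; nra.
Qed.

End Codes.

(** * Entropy *)

Section Entropy.
Variable R : realType.
Local Open Scope ereal_scope.

Lemma limn_esup_near_le (u : (\bar R)^nat) (l : \bar R) :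
  (\forall n \near \oo, u n <= l) -> limn_esup u <= l.
Proof.
move=> ul; apply: ereal_inf_le;
  exists (ereal_sup [set u n | n in [set n | u n <= l]]).
  by exists [set n | u n <= l].
by apply: ge_ereal_sup => _ [n un <-].
Qed.

Lemma limn_esup_ge (u : (\bar R)^nat) (l : \bar R) :
  (forall n, l <= u n) -> l <= limn_esup u.
Proof.
move=> ul; apply: le_ereal_inf_tmp => _ [B nB <-].
have [N _ /(_ N (leqnn N)) BN] := nB.
by apply: (le_trans (ul N)); apply: ereal_sup_ubound; exists N.
Qed.

End Entropy.

(** * Separated sets in the hull and vanishing entropy *)

Section DeloneEntropy.
Variables (R : realType) (G : lcaGroupType).
Variable theta : {measure set (borel (0 : G)) -> \bar R}.
Hypothesis haar : is_haar theta.
Hypothesis noncompact : ~ compact [set: G].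
Variable omega : set G.
Hypothesis omega_ud : uniformly_discrete omega.
Hypothesis omega_pp : pure_point_diffractive theta omega.
Variable A : nat -> set G.
Hypothesis vA : van_hove theta A.

Local Notation pi := (delone_action (omega := omega)).

(** Translation by [g] moves [p] into [K] exactly when [p] lies in [K - g], so closeness on the
    single window [K - B] controls all translates by elements of [B]. *)
Lemma bowen_rubber (eta : set (hull omega * hull omega)) K V B
    (x y : hull omega) :
  (forall x y : hull omega, rubber_eps K V (val x, val y) -> eta (x, y)) ->
  (forall p, closed_subset_val (val x) p -> reflected K B 0 p ->
     exists2 q, closed_subset_val (val y) q & V (p - q)) ->
  (forall p, closed_subset_val (val y) p -> reflected K B 0 p ->
     exists2 q, closed_subset_val (val x) q & V (p - q)) ->
  bowen pi eta B (x, y).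
Proof.
move=> KVeta xy yx g Bg; apply: KVeta.
have half (z w : hull omega) :
    (forall p, closed_subset_val (val z) p -> reflected K B 0 p ->
     exists2 q, closed_subset_val (val w) q & V (p - q)) ->
    shiftset (val z) g `&` K `<=` sumset (shiftset (val w) g) V.
  move=> zw _ [[p zp <-] Kp]; have [|q wq Vpq] := zw p zp.
    by apply/reflectedP; exists (p + g), g; split=> //; zmod.
  exists (q + g); first by exists q.
  by exists (p - q) => //; zmod.
by split; exact: half.
Qed.

(** Replace each hull element by a nearby translate of [omega]. Equal codes of these translates make
    the elements Bowen-close, so the code is injective on a separated set. *)
Lemma sep_growth (eta : set (hull omega * hull omega)) (delta : R) :
  set_nbhs diagonal eta -> 0 < delta -> \forall n \near \oo,
    (sep R (bowen pi eta (A n)) <= (expR (delta * fine (theta (A n))))%:E)%E.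
Proof.
move=> neta delta0; have [K [V [cK nV KVeta]]] := hull_entourage neta.
have [Ua [gUa _ UaV]] := sym_nbhd_half nV.
have [Ub [gUb sUb UbUa]] := sym_nbhd_half (sym_nbhd_nbhs gUa).
have [_ Ub0 _ [Q cQ UbQ]] := gUb.
have Q0 : Q 0 by exact: UbQ.
(* Passing from [x] to its translate, then to the other translate, then to [y] moves a point three
   times; the intermediate points lie in the windows of [K2] and [K3]. *)
pose K2 := sumset K Q; have cK2 : compact K2 by exact: compact_sumset.
pose K3 := sumset K2 Q; have cK3 : compact K3 by exact: compact_sumset.
have := few_codes haar omega_ud omega_pp vA noncompact cK2 (sym_nbhd_nbhs gUb)
  delta0.
apply: filterS => n [T [D [code [codeD leD decode]]]].
have [cA _ _] := vA.
have approx (x : hull omega) := hull_approx x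
  (compact_reflected (h := 0) cK3 (cA n)) (sym_nbhd_nbhs gUb).
pose h x := projT1 (cid (approx x)).
have hP (x : hull omega) : val x `&` reflected K3 (A n) 0 `<=` sumset (shiftset
  omega (h x)) Ub /\
    shiftset omega (h x) `&` reflected K3 (A n) 0 `<=` sumset (val x) Ub :=
  projT2 (cid (approx x)).
have thicken L p q : reflected L (A n) 0 p -> Ub (p - q) ->
    reflected (sumset L Q) (A n) 0 q.
  move=> /reflectedP[k [a [Lk Aa ->]]] Upq; apply/reflectedP.
  exists (q + a), a; split=> //; last by zmod.
  exists k => //; exists (q - (k - a + 0)); last by zmod.
  by apply: UbQ; exact: sym_nbhdN.
have sK L p : reflected L (A n) 0 p -> reflected (sumset L Q) (A n) 0 p.
  by move=> Lp; apply: thicken Lp _; rewrite subrr.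
have close (x y : hull omega) : code (h x) = code (h y) -> forall p,
    closed_subset_val (val x) p -> reflected K (A n) 0 p ->
    exists2 q, closed_subset_val (val y) q & V (p - q).
  move=> exy p xp Kp; have [hx _] := hP x; have [_ hy] := hP y.
  have [q oq [v Uv qvp]] := hx p (conj xp (sK _ _ (sK _ _ Kp))).
  have Upq : Ub (p - q) by rewrite -qvp addrC addKr.
  have K2q := thicken _ _ _ Kp Upq.
  have oq' : omega (q - h x) by move: oq; rewrite shiftsetE.
  have [q' oq'' Uqq'] := decode _ _ exy q oq' K2q.
  have K3q' := thicken _ _ _ K2q Uqq'.
  have [|z yz [w Uw zwq]] := hy q' (conj _ K3q'); first by rewrite shiftsetE.
  exists z => //; apply: (UaV _ q'); first exact: UbUa Upq Uqq'.
  by apply: sUb; rewrite -zwq addrC addKr.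
apply: ge_ereal_sup => _ [E Esep <-]; rewrite lee_fin; apply: le_trans leD.
have inj : {in E &, injective (code \o h)}.
  move=> x y xE yE /= exy; apply/eqP/negPn/negP => xy.
  apply: (Esep x y xE yE xy); apply: bowen_rubber KVeta _ _.
    exact: close.
  exact: close (esym exy).
rewrite ler_nat cardE -(size_map (code \o h)); apply: uniq_leq_size.
  by rewrite map_inj_in_uniq ?fset_uniq.
by move=> _ /mapP[x xE ->]; rewrite mem_enum; exact: codeD.
Qed.

End DeloneEntropy.

Theorem theorem3p6 (R : realType) (G : lcaGroupType)
    (G_sigma_compact : sigma_compact G) (G_noncompact : ~ compact [set: G])
    (theta : {measure set (borel (0 : G)) -> \bar R})
    (theta_haar : is_haar theta)
    (omega : set G) (omega_delone : delone omega) (omega_FLC : FLC omega)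
    (omega_UPF : UPF theta omega)
    (omega_pp : pure_point_diffractive theta omega)
    (A : nat -> set G) (A_van_hove : van_hove theta A) :
  htop (delone_action (omega := omega)) theta A = 0%E.
Proof.
have [_ omega_ud] := omega_delone; have [cA A0 _] := A_van_hove.
have m0 n : 0 < fine (theta (A n)) by rewrite fine_gt0// A0 haar_compact_lty.
(* A point of the hull makes every [sep] at least 1, so that its logarithm is nonnegative. *)
have [x0 hx0] : exists x : hull omega, True.
  pose xi := ClosedSubset (uniformly_discrete_closed omega_ud).
  have hxi : hull omega xi.
    apply: subset_closure; exists 0; apply/seteqP; split=> p /=.
      by move=> op; exists p; rewrite ?addr0.
    by move=> [q oq <-]; rewrite addr0.
  by exists (exist _ xi (mem_set hxi)).
have sep_ge1 eta n : (1 <= sep R (bowen (delone_action (omega := omega)) eta (A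
  n)))%E.
  apply: ereal_sup_ubound; exists [fset x0]%fset; last by rewrite cardfs1.
  by move=> x y /fset1P-> /fset1P->; rewrite eqxx.
apply/eqP; rewrite eq_le; apply/andP; split.
  apply: ge_ereal_sup => _ [eta [neta _] <-].
  apply/lee_addgt0Pr => delta delta0; rewrite add0e; apply: limn_esup_near_le.
  have := sep_growth theta_haar G_noncompact omega_ud omega_pp A_van_hove neta
    delta0.
  apply: filterS => n le_sep; rewrite lee_pdivrMr// -EFinM.
  have itvE (z : \bar R) : (0 <= z)%E -> z \in `[0%E, +oo%E]%R.
    by move=> z0; rewrite in_itv/= z0 leey.
  rewrite -[leRHS](@expeRK R) lee_lne ?itvE//.
    exact: le_trans (sep_ge1 _ _).
  by rewrite lee_fin expR_ge0.
(* The relation [setT] is admissible in the supremum and already yields nonnegative terms. *)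
apply: ereal_sup_ge; exists (limn_esup (fun n =>
    (lne (sep R (bowen (delone_action (omega := omega)) setT (A n))) *
     (fine (theta (A n)))^-1%:E)%E)).
  by exists setT => //; split=> //; exact: filterT.
apply: limn_esup_ge => n; apply: mule_ge0; first by rewrite lne_ge0.
by rewrite lee_fin invr_ge0 ltW.
Qed.
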